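(* Let $n>1$ and let $P(z)=z^n+c_{n-1}z^{n-1}+\dots+c_1z+c_0\in\mathbb C[z]$. Suppose that the set $B_{P}$ of critical values of $P$ consists of exactly $n-1$ distinct points. Then the braid monodromy group of $P$ is the whole braid group: $\Gamma_{P}=\mathrm{Br}_n$.
   Context: Let $\Pi=\mathbb C$ (the source plane) and let $p_P:\Pi\to\mathbb C$, $w=P(z)$. Let $C_P=\{z: P'(z)=0\}$ be the critical points and $B_P=p_P(C_P)$ the critical values, so $p_P:\Pi\setminus p_P^{-1}(B_P)\to\mathbb C\setminus B_P$ is an unramified $n$-sheeted cover. Fix $w_0\in\mathbb C\setminus B_P$ and let $K=p_P^{-1}(w_0)$ ($n$ distinct points). Denote by $\mathrm{Br}_n[\Pi,K]$ the braid group of the plane with $n$ strands based at $K$ (isotopy classes of $n$ pairwise disjoint paths $(b_j(t),t)$ in $\Pi\times[0,1]$ starting at $K\times\{0\}$ and ending in $K\times\{1\}$), which is isomorphic to the abstract braid group $\mathrm{Br}_n$. For a loop $\lambda$ in $\mathbb C\setminus B_P$ based at $w_0$, the preimage $p_P^{-1}(\lambda)$ consists of $n$ disjoint paths forming a geometric braid $b(\lambda)$; this gives the braid monodromy homomorphism $\beta_P:\pi_1(\mathbb C\setminus B_P,w_0)\to\mathrm{Br}_n[\Pi,K]$, and its image $\Gamma_P$ is the braid monodromy group of $P$. *)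

(* Defs.v *)
(* The complex plane is modelled as
   R[i] (mathcomp-real-closed `complex`) over an arbitrary R : realType,
   equipped with its norm (modulus) topology via the regular copy ^o. *)
From HB Require Import structures.
From mathcomp Require Import all_boot all_order all_algebra.
From mathcomp Require Import complex.
From mathcomp Require Import all_classical all_reals topology normedtype.
Set Implicit Arguments.
Unset Strict Implicit.
Unset Printing Implicit Defensive.
Import Order.TTheory GRing.Theory Num.Theory.
Import numFieldTopology.Exports numFieldNormedType.Exports.
Local Open Scope ring_scope.
Local Open Scope classical_set_scope.

Notation CC R := ((R[i])^o).

Section Braids.
Variable R : realType.

Definition crit_points (P : {poly CC R}) : set (CC R) :=
  [set z | root P^`() z].
Definition crit_values (P : {poly CC R}) : set (CC R) :=
  [set P.[z] | z in crit_points P].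

Definition fibre (P : {poly CC R}) (w0 : CC R) : set (CC R) :=
  [set z | P.[z] = w0].

(* A geometric braid with n strands in the plane based at K: n strands
   t |-> b j t, t in [0,1], continuous, pairwise disjoint at every time,
   starting in K x {0} and ending in K x {1}.  (The strands through the
   points of K are the paths (b_j(t),t) in Pi x [0,1].) *)
Definition is_braid (n : nat) (K : set (CC R)) (b : 'I_n -> R -> CC R) : Prop :=
  [/\ forall j, {within `[0, 1], continuous (b j)},
      forall t, t \in `[0, 1] -> injective (fun j => b j t),
      (fun j => b j 0) @` setT = K
    & (fun j => b j 1) @` setT = K].

Definition braid_isotopic (n : nat) (K : set (CC R))
    (b b' : 'I_n -> R -> CC R) : Prop :=
  exists H : R -> 'I_n -> R -> CC R,
    [/\ forall j, {within `[0, 1] `*` `[0, 1],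
                     continuous (fun st : R * R => H st.1 j st.2)},
        forall s, s \in `[0, 1] -> is_braid K (H s),
        forall s j, s \in `[0, 1] -> H s j 0 = b j 0 /\ H s j 1 = b j 1,
        forall j t, t \in `[0, 1] -> H 0 j t = b j t
      & forall j t, t \in `[0, 1] -> H 1 j t = b' j t].

Definition is_loop_in (B : set (CC R)) (w0 : CC R) (lam : R -> CC R) : Prop :=
  [/\ {within `[0, 1], continuous lam},
      lam 0 = w0, lam 1 = w0
    & forall t, t \in `[0, 1] -> ~ B (lam t)].

Definition lifted_braid (n : nat) (P : {poly CC R}) (w0 : CC R)
    (lam : R -> CC R) (b : 'I_n -> R -> CC R) : Prop :=
  is_braid (fibre P w0) b /\
  forall j t, t \in `[0, 1] -> P.[b j t] = lam t.

(* Gamma_P = Br_n[Pi, K]: every isotopy class of geometric braids based at K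
   is the class of b(lam) for some loop lam in C \ B_P based at w0. *)
Definition monodromy_surjective (n : nat) (P : {poly CC R}) (w0 : CC R) : Prop :=
  forall b : 'I_n -> R -> CC R, is_braid (fibre P w0) b ->
    exists lam : R -> CC R, exists b' : 'I_n -> R -> CC R,
      [/\ is_loop_in (crit_values P) w0 lam,
          lifted_braid P w0 lam b'
        & braid_isotopic (fibre P w0) b' b].

End Braids.

(* Main.v *)
(* A braid based at the fibre over w0 is a loop in the space of monic
   polynomials of degree n with simple roots. Moving its roots slightly makes
   every polynomial Q_t of the loop have n - 1 distinct critical values v_i(t),
   because on a complex line in the space of roots this genericity fails only at
   the zeros of one polynomial. View the loop as Q_t - w(t), where w = 0 avoids
   the moving points v_i(t), and extend it by a path of w from 0 to a large M and
   back. Transporting w along the motion of the v_i deforms the loop into a path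
   inside the line Q_0 - C, followed by the loop Q_t - M and by a path back inside
   Q_0 - C. No critical value reaches M along the straight homotopy from Q_t to
   Q_0, so the middle loop contracts. What remains lies in P - C, hence is the
   lift of a loop in the complement of the critical values of P. *)
Require Import Defs.
From HB Require Import structures.
From mathcomp Require Import all_boot all_order all_algebra.
From mathcomp Require Import complex.
From mathcomp Require Import all_classical all_reals topology normedtype.
From mathcomp Require Import ring lra.
Set Implicit Arguments.
Unset Strict Implicit.
Unset Printing Implicit Defensive.
Import Order.TTheory GRing.Theory Num.Theory.
Import numFieldTopology.Exports numFieldNormedType.Exports.
Local Open Scope ring_scope.
Local Open Scope classical_set_scope.

(** The argument runs in the space of monic polynomials with simple roots; strands return only at
    the end, because a homotopy of polynomial paths with fixed endpoints lifts to an isotopy with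
    fixed ends. Genericity turns the critical values into m disjoint continuous punctures; if two of
    them met, no motion of the plane could carry [w] along with them. The detour through [M]
    separates two difficulties. The path towards [M] stays in the plane of values and can be dragged
    along with the punctures. The loop of polynomials can be contracted by convexity, but only after
    a shift by [M]: critical values are bounded in terms of the coefficients, and a bound on the
    coefficients survives convex combinations. All paths are extended from the unit interval to the
    whole line by clamping, so that ordinary continuity can be used and paths are glued by adding
    frozen pieces. *)

Section Modulus.
Variable R : realType.
Notation C := (CC R).
Implicit Types z w : C.

(** The norm of [CC R] takes its values in [R[i]]; with the real part, estimates live in the totally
    ordered field [R], where [lra] applies. *)
Definition cmod z : R := complex.Re `|z|.

Lemma cmodE z : `|z| = (cmod z)%:C%C.
Proof. by rewrite /cmod normc_def. Qed.

Lemma cmod_ge0 z : 0 <= cmod z.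
Proof. by rewrite -lecR -cmodE normr_ge0. Qed.

Lemma cmod_eq0 z : (cmod z == 0) = (z == 0).
Proof.
apply/eqP/eqP => [h|->]; last by rewrite /cmod normr0.
by apply/eqP; rewrite -normr_eq0 cmodE h.
Qed.

Lemma cmod0 : cmod 0 = 0.
Proof. by apply/eqP; rewrite cmod_eq0. Qed.

Lemma cmod_gt0 z : (0 < cmod z) = (z != 0).
Proof. by rewrite lt_def cmod_ge0 andbT cmod_eq0. Qed.

Lemma cmodN z : cmod (- z) = cmod z.
Proof. by rewrite /cmod normrN. Qed.

Lemma cmodC z w : cmod (z - w) = cmod (w - z).
Proof. by rewrite -cmodN opprB. Qed.

Lemma cmodM z w : cmod (z * w) = cmod z * cmod w.
Proof.
have := normrM z w; rewrite !cmodE -rmorphM /= => /(congr1 (@complex.Re _)).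
by [].
Qed.

Lemma cmod1 : cmod 1 = 1.
Proof. by rewrite /cmod normr1. Qed.

Lemma cmodX z k : cmod (z ^+ k) = cmod z ^+ k.
Proof. by elim: k => [|k IH]; rewrite ?expr0 ?cmod1 // !exprS cmodM IH. Qed.

Lemma cmodD z w : cmod (z + w) <= cmod z + cmod w.
Proof. by have := ler_normD z w; rewrite !cmodE -rmorphD lecR. Qed.

Lemma cmodB z w : cmod (z - w) <= cmod z + cmod w.
Proof. by rewrite -(cmodN w) cmodD. Qed.

Lemma cmod_tri u z w : cmod (z - w) <= cmod (z - u) + cmod (u - w).
Proof. by rewrite -[z - w](subrKA u) cmodD. Qed.

Lemma cmod_real (x : R) : cmod (x%:C%C : C) = `|x|.
Proof.
rewrite /cmod normc_def /= expr0n /= addr0 sqrtr_sqr //.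
Qed.

Lemma cmod_sum (I : Type) (r : seq I) (P : pred I) (F : I -> C) :
  cmod (\sum_(i <- r | P i) F i) <= \sum_(i <- r | P i) cmod (F i).
Proof.
elim/big_rec2: _ => [|i y x _ h]; first by rewrite cmod0.
by rewrite (le_trans (cmodD _ _)) // lerD2l.
Qed.

Lemma cmod_prod (I : Type) (r : seq I) (P : pred I) (F : I -> C) :
  cmod (\prod_(i <- r | P i) F i) = \prod_(i <- r | P i) cmod (F i).
Proof. by elim/big_rec2: _ => [|i y x _ <-]; rewrite ?cmod1 // cmodM. Qed.

Lemma cvg_cmodP (T : Type) (F : set_system T) {FF : Filter F} (f : T -> C) (l : C) :
  f x @[x --> F] --> l <-> forall e : R, 0 < e -> \forall x \near F, cmod (l - f x) < e.
Proof.
split=> [/cvgrPdist_lt h e e0|h].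
  have e0' : 0 < (e%:C%C : C) by rewrite ltcR.
  by have := h _ e0'; apply: filterS => x; rewrite cmodE ltcR.
apply/cvgrPdist_lt => e e0.
have eR : e = (complex.Re e)%:C%C.
  by rewrite RRe_real // realE ltW.
rewrite eR ltcR in e0.
have := h _ e0; apply: filterS => x hx; by rewrite cmodE eR ltcR.
Qed.

Lemma continuous_cmodP (T : topologicalType) (f : T -> C) :
  continuous f <->
  forall x (e : R), 0 < e -> \forall y \near x, cmod (f x - f y) < e.
Proof.
split=> h x; first by have /cvg_cmodP := h x.
by apply/cvg_cmodP; exact: h.
Qed.

Lemma continuous_cmod (T : topologicalType) (f : T -> C) :
  continuous f -> continuous (fun x => cmod (f x)).
Proof.
move=> /continuous_cmodP h z; apply/cvgrPdist_lt => e e0.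
near=> w; have : cmod (f z - f w) < e by near: w; exact: h.
apply: le_lt_trans.
rewrite ler_norml; have := cmod_tri (f w) (f z) 0.
have := cmod_tri (f z) (f w) 0.
rewrite !subr0 (cmodC (f w) (f z)); lra.
Unshelve. all: by end_near. Qed.

Lemma continuous_real (T : topologicalType) (f : T -> R) :
  continuous f -> continuous (fun x => (f x)%:C%C : C).
Proof.
move=> cf; apply/continuous_cmodP => x e e0.
have /cvgrPdist_lt/(_ e e0) H := cf x; near=> y.
by rewrite -rmorphB cmod_real; near: y.
Unshelve. all: by end_near. Qed.

End Modulus.

(** * Closure rules for continuous functions *)

Section Continuity.
Variables (K : numFieldType) (T : topologicalType).
Implicit Types f g : T -> K.

Lemma continuous_add f g :
  continuous f -> continuous g -> continuous (fun x => f x + g x).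
Proof. by move=> cf cg x; apply: cvgD; [exact: cf|exact: cg]. Qed.

Lemma continuous_opp f : continuous f -> continuous (fun x => - f x).
Proof. by move=> cf x; apply: cvgN; exact: cf. Qed.

Lemma continuous_sub f g :
  continuous f -> continuous g -> continuous (fun x => f x - g x).
Proof. by move=> cf cg; exact/continuous_add/continuous_opp. Qed.

Lemma continuous_mul f g :
  continuous f -> continuous g -> continuous (fun x => f x * g x).
Proof. by move=> cf cg x; apply: cvgM; [exact: cf|exact: cg]. Qed.

Lemma continuous_const (S : topologicalType) (c : S) :
  continuous (fun _ : T => c).
Proof. by move=> x; exact: cvg_cst. Qed.

Lemma continuous_ident : continuous (fun x : T => x).
Proof. by move=> x; exact: cvg_id. Qed.

Lemma continuous_exp f k : continuous f -> continuous (fun x => f x ^+ k).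
Proof.
move=> cf; elim: k => [|k IH]; first exact: continuous_const.
have -> : (fun x => f x ^+ k.+1) = (fun x => f x * f x ^+ k).
  by apply/funext => x; rewrite exprS.
exact: continuous_mul.
Qed.

Lemma continuous_sum (I : Type) (r : seq I) (P : pred I) (F : I -> T -> K) :
  (forall i, continuous (F i)) ->
  continuous (fun x => \sum_(i <- r | P i) F i x).
Proof.
move=> cF; elim: r => [|i r IH].
  under eq_fun do rewrite big_nil; exact: continuous_const.
under eq_fun do rewrite big_cons.
case: (P i) => //; exact: continuous_add.
Qed.

End Continuity.

Lemma continuous_compose (S T U : topologicalType) (f : S -> T) (g : T -> U) :
  continuous f -> continuous g -> continuous (fun x => g (f x)).
Proof. by move=> cf cg x; apply: continuous_comp; [exact: cf|exact: cg]. Qed.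

Lemma continuous_pair (S T U : topologicalType) (f : S -> T) (g : S -> U) :
  continuous f -> continuous g -> continuous (fun x => (f x, g x)).
Proof. by move=> cf cg x; apply: cvg_pair; [exact: cf|exact: cg]. Qed.

Lemma continuous_maxr (R : realType) (T : topologicalType) (f g : T -> R) :
  continuous f -> continuous g -> continuous (fun x => Num.max (f x) (g x)).
Proof. by move=> cf cg x; apply: continuous_max; [exact: cf|exact: cg]. Qed.

Lemma continuous_minr (R : realType) (T : topologicalType) (f g : T -> R) :
  continuous f -> continuous g -> continuous (fun x => Num.min (f x) (g x)).
Proof. by move=> cf cg x; apply: continuous_min; [exact: cf|exact: cg]. Qed.

(** * Retraction of the line onto the unit interval *)

Section Clamp.
Variable R : realType.
Implicit Types s t : R.

Definition clamp t : R := Num.max 0 (Num.min 1 t).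

Lemma clamp_ge0 t : 0 <= clamp t.
Proof. by rewrite /clamp le_max lexx. Qed.

Lemma clamp_le1 t : clamp t <= 1.
Proof. by rewrite /clamp ge_max ler01 ge_min lexx. Qed.

Lemma clampE t : 0 <= t <= 1 -> clamp t = t.
Proof.
by case/andP=> t0 t1; rewrite /clamp (min_idPr t1) (max_idPr t0).
Qed.

Lemma clampP t : [/\ clamp t = 0 & t <= 0] \/
  [/\ clamp t = t & 0 <= t <= 1] \/ [/\ clamp t = 1 & 1 <= t].
Proof.
case/orP: (le_total t 0) => h.
  left; split=> //; apply/max_idPl; rewrite ge_min h orbT //.
case/orP: (le_total t 1) => h'.
  have t01 : 0 <= t <= 1 by rewrite h h'.
  by right; left; split=> //; exact: clampE.
right; right; split=> //.
by rewrite /clamp (min_idPl h') (max_idPr ler01).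
Qed.

Lemma clamp01 t : 0 <= clamp t <= 1.
Proof. by rewrite clamp_ge0 clamp_le1. Qed.

Lemma clamp0 : clamp 0 = 0.
Proof. by rewrite clampE // lexx ler01. Qed.

Lemma clamp1 : clamp 1 = 1.
Proof. by rewrite clampE // ler01 lexx. Qed.

Lemma clamp_low t : t <= 0 -> clamp t = 0.
Proof. by move=> t0; apply/max_idPl; rewrite ge_min t0 orbT. Qed.

Lemma clamp_high t : 1 <= t -> clamp t = 1.
Proof. by move=> t1; rewrite /clamp (min_idPl t1) (max_idPr ler01). Qed.

Lemma clampK t : clamp (clamp t) = clamp t.
Proof. by rewrite clampE // clamp01. Qed.

Lemma clamp_lip s t : `|clamp s - clamp t| <= `|s - t|.
Proof.
wlog st : s t / s <= t => [hw|].
  case: (leP s t) => h; first exact: hw.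
  by rewrite distrC (distrC s); apply: hw; rewrite ltW.
rewrite distrC (distrC s) (ger0_norm (_ : 0 <= t - s)) ?subr_ge0 //.
rewrite ler_norml.
case: (clampP s) => [[-> ?]|[[-> /andP[? ?]]|[-> ?]]];
case: (clampP t) => [[-> ?]|[[-> /andP[? ?]]|[-> ?]]]; lra.
Qed.

Lemma continuous_clamp (T : topologicalType) (f : T -> R) :
  continuous f -> continuous (fun x => clamp (f x)).
Proof.
move=> cf; apply: continuous_maxr; first exact: continuous_const.
by apply: continuous_minr => //; exact: continuous_const.
Qed.

End Clamp.

(** Near-covering compactness for the filter of small positive [d]. The local hypothesis covers all
    small [d], so [P] need not be monotone in [d]. *)
Lemma compact_uniform (R : realType) (X : topologicalType) (A : set X)
    (P : R -> X -> Prop) :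
  compact A ->
  (forall x, A x -> exists2 e : R, 0 < e &
     \forall y \near x, forall d, 0 < d -> d < e -> P d y) ->
  exists2 d : R, 0 < d & forall x, A x -> P d x.
Proof.
move=> /compact_near_coveringP cA h.
have : \forall d \near (0:R)^'+, A `<=` P d.
  apply: cA => x Ax; have [e e0 he] := h x Ax.
  exists ([set y | forall d, 0 < d -> d < e -> P d y], [set d | 0 < d < e]).
    split => //=; near=> d; apply/andP; split; near: d.
      exact: nbhs_right_gt.
    exact: nbhs_right_lt.
  by move=> [y d] /= [hy /andP[d0 de]]; exact: hy.
move=> H; near (0:R)^'+ => d; exists d => [|x Ax]; last exact: (near H).
by [].
Unshelve. all: by end_near. Qed.

Lemma compact_unit (R : realType) : compact [set t : R | 0 <= t <= 1].
Proof.
have -> : [set t : R | 0 <= t <= 1] = `[0, 1].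
  by apply/seteqP; split=> t /=; rewrite in_itv.
exact: segment_compact.
Qed.

Lemma compact_square (R : realType) :
  compact [set x : R * R | (0 <= x.1 <= 1) /\ (0 <= x.2 <= 1)].
Proof.
have -> : [set x : R * R | (0 <= x.1 <= 1) /\ (0 <= x.2 <= 1)] =
  [set t : R | 0 <= t <= 1] `*` [set t : R | 0 <= t <= 1] by [].
by apply: compact_setX; exact: compact_unit.
Qed.

Lemma finite_lower_bound (R : realType) (I : finType) (P : pred I) (f : I -> R) :
  (forall i, P i -> 0 < f i) ->
  exists2 d : R, 0 < d & forall i, P i -> d <= f i.
Proof.
move=> f0; exists (\big[Num.min/1]_(i | P i) f i).
  by elim/big_ind: _ => [|x y x0 y0|i /f0 //]; rewrite ?ltr01 // lt_min x0.
by move=> i Pi; rewrite (bigD1 i) //= ge_min lexx.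
Qed.

(** Heine-Cantor, with one modulus of continuity for the whole finite family. *)
Lemma continuous_uniform01 (R : realType) (I : finType) (f : I -> R -> CC R)
    (e : R) : 0 < e -> (forall i, continuous (f i)) ->
  exists2 d : R, 0 < d & forall i s t, 0 <= s <= 1 -> 0 <= t <= 1 ->
    `|s - t| < d -> cmod (f i s - f i t) < e.
Proof.
move=> e0 cf.
have [d d0 hd] : exists2 d : R, 0 < d & forall s, [set t : R | 0 <= t <= 1] s ->
    forall i t, `|s - t| < d -> cmod (f i s - f i t) < e.
  apply: compact_uniform; first exact: compact_unit.
  move=> x _.
  have /= H : \forall y \near x, forall i, cmod (f i x - f i y) < e / 2.
    apply: (filter_forall (nbhs_filter x)) => i.
    by have /continuous_cmodP := cf i; apply; rewrite divr_gt0.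
  have /nbhs_ballP [/= r r0 hr] := H.
  exists (r / 2); first by rewrite divr_gt0.
  near=> y => d d0 dr i t yt.
  have xy : `|x - y| < r / 2.
    near: y; apply: nbhsx_ballx; rewrite divr_gt0 //.
  rewrite (le_lt_trans (cmod_tri (f i x) _ _)) // [e]splitr ltrD //.
    rewrite cmodC; apply: (hr y); rewrite /ball /=; apply: lt_le_trans xy _; lra.
  apply: (hr t); rewrite /ball /= -(subrKA y).
  by rewrite (le_lt_trans (ler_normD _ _)) // [r]splitr ltrD // (lt_trans yt).
by exists d => // i s t hs _; exact: hd.
Unshelve. all: by end_near. Qed.

(** * Continuous families of polynomials *)

Section PolyFamilies.
Variables (R : realType).
Notation C := (CC R).

Definition cpoly (T : topologicalType) (Q : T -> {poly C}) :=
  forall i, continuous (fun x => (Q x)`_i).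

Section Closure.
Variable T : topologicalType.
Implicit Types P Q : T -> {poly C}.

Lemma cpoly_const (p : {poly C}) : cpoly (fun _ : T => p).
Proof. by move=> i; exact: continuous_const. Qed.

Lemma cpolyC (f : T -> C) : continuous f -> cpoly (fun x => (f x)%:P).
Proof.
move=> cf i; under eq_fun do rewrite coefC.
by case: (i == 0)%N => /=; [exact: cf|exact: continuous_const].
Qed.

Lemma cpolyD P Q : cpoly P -> cpoly Q -> cpoly (fun x => P x + Q x).
Proof. by move=> cP cQ i; under eq_fun do rewrite coefD; exact: continuous_add. Qed.

Lemma cpolyB P Q : cpoly P -> cpoly Q -> cpoly (fun x => P x - Q x).
Proof. by move=> cP cQ i; under eq_fun do rewrite coefB; exact: continuous_sub. Qed.

Lemma cpolyM P Q : cpoly P -> cpoly Q -> cpoly (fun x => P x * Q x).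
Proof.
move=> cP cQ i; under eq_fun do rewrite coefM.
by apply: continuous_sum => j; exact: continuous_mul.
Qed.

Lemma cpolyZ (f : T -> C) Q :
  continuous f -> cpoly Q -> cpoly (fun x => f x *: Q x).
Proof.
move=> cf cQ i; under eq_fun do rewrite coefZ.
by apply: continuous_mul; [exact: cf|exact: cQ].
Qed.

Lemma cpoly_deriv Q : cpoly Q -> cpoly (fun x => (Q x)^`()).
Proof.
move=> cQ i; under eq_fun do rewrite coef_deriv -mulr_natr.
by apply: continuous_mul => //; exact: continuous_const.
Qed.

Lemma cpoly_prod_XsubC n (b : 'I_n -> T -> C) : (forall j, continuous (b j)) ->
  cpoly (fun x => \prod_(j < n) ('X - (b j x)%:P)).
Proof.
elim: n b => [|n IH] b cb.
  under eq_fun do rewrite big_ord0; exact: cpoly_const.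
under eq_fun do rewrite big_ord_recl.
apply: cpolyM; last by apply: (IH (fun j => b (lift ord0 j))) => j.
by apply: cpolyB; [exact: cpoly_const|exact: cpolyC].
Qed.

(** The common degree bound turns evaluation into one fixed finite sum of continuous terms. *)
Lemma continuous_horner Q (f : T -> C) N : (forall x, (size (Q x) <= N)%N) ->
  cpoly Q -> continuous f -> continuous (fun x => (Q x).[f x]).
Proof.
move=> sQ cQ cf.
have -> : (fun x => (Q x).[f x]) = (fun x => \sum_(i < N) (Q x)`_i * f x ^+ i).
  by apply/funext => x; rewrite (horner_coef_wide _ (sQ x)).
apply: continuous_sum => i.
by apply: continuous_mul; [exact: cQ|exact: continuous_exp].
Qed.

End Closure.

Lemma cpoly_compose (S T : topologicalType) (f : S -> T) (Q : T -> {poly C}) :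
  continuous f -> cpoly Q -> cpoly (fun x => Q (f x)).
Proof. by move=> cf cQ i; exact: (continuous_compose cf (cQ i)). Qed.

End PolyFamilies.

(** * Continuous dependence of roots on coefficients *)

Section Roots.
Variables (R : realType) (n : nat).
Notation C := (CC R).
Implicit Types (p q : {poly C}) (b : 'I_n -> C).

Definition coef_close (e : R) p q := forall i, cmod (p`_i - q`_i) < e.

Definition prodX b : {poly C} := \prod_(j < n) ('X - (b j)%:P).

(** Quantitative form of [split_simple]: the gap [d] makes the choice of a nearby root
    unambiguous. *)
Definition split_sep (d : R) p := exists2 b, p = prodX b &
  forall i j, i != j -> d <= cmod (b i - b j).

Definition split_simple p := exists2 b, p = prodX b & injective b.

Lemma prodX_monic b : prodX b \is monic.
Proof. exact: monic_prod_XsubC. Qed.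

Lemma size_prodX b : size (prodX b) = n.+1.
Proof. by rewrite size_prod_XsubC -[index_enum _]enumT size_enum_ord. Qed.

Lemma root_prodX b z : root (prodX b) z -> exists j, z = b j.
Proof.
rewrite /root horner_prod => /eqP h.
have /eqP : \prod_(j < n) ('X - (b j)%:P).[z] == 0 by rewrite h.
move/eqP/prodf_eq0 => [j _]; rewrite hornerXsubC subr_eq0 => /eqP ->.
by exists j.
Qed.

Lemma prodX_root b j : root (prodX b) (b j).
Proof.
by rewrite /root horner_prod (bigD1 j) //= hornerXsubC subrr mul0r.
Qed.

Lemma prodX_eq p b : p \is monic -> size p = n.+1 -> injective b ->
  (forall j, root p (b j)) -> p = prodX b.
Proof.
move=> pm sp ib rb.
have := @all_roots_prod_XsubC _ p [seq b j | j <- enum 'I_n].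
rewrite size_map size_enum_ord sp (monicP pm) scale1r big_map big_enum /=.
apply=> //.
  by apply/allP => _ /mapP[j _ ->].
by rewrite uniq_rootsE map_inj_uniq // enum_uniq.
Qed.

Lemma split_simple_monic p : split_simple p -> p \is monic.
Proof. by case=> b -> _; exact: prodX_monic. Qed.

Lemma split_simple_size p : split_simple p -> size p = n.+1.
Proof. by case=> b -> _; exact: size_prodX. Qed.

Lemma inj_separated b : injective b ->
  exists2 d : R, 0 < d & forall i j, i != j -> d <= cmod (b i - b j).
Proof.
move=> ib.
have [[i j] /= ij|d d0 h] := @finite_lower_bound R _
  (fun ij : 'I_n * 'I_n => ij.1 != ij.2) (fun ij => cmod (b ij.1 - b ij.2)).
  by rewrite cmod_gt0 subr_eq0; apply: contra_neq ij; exact: ib.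
by exists d => // i j ij; exact: (h (i, j)).
Qed.

Lemma split_sepE d p z w : split_sep d p -> root p z -> root p w ->
  cmod (z - w) < d -> z = w.
Proof.
case=> b -> h /root_prodX[i ->] /root_prodX[j ->].
have [->//|ij] := eqVneq i j; by rewrite ltNge h.
Qed.

Lemma monic_split p : p \is monic -> size p = n.+1 -> exists b, p = prodX b.
Proof.
move=> pm sp; have [r pr] := closed_field_poly_normal p.
rewrite (monicP pm) scale1r in pr.
have sr : size r = n by move: sp; rewrite pr size_prod_XsubC => -[].
exists (fun j => nth 0 r j); rewrite pr /prodX.
by rewrite (big_nth 0) sr big_mkord.
Qed.

(** If the modulus of [z] exceeds 1, isolating the leading term of p(z) = 0 gives |z|^n <= n B
    |z|^(n-1). *)
Lemma root_bound p (B : R) z : p \is monic -> size p = n.+1 ->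
  (forall i, cmod p`_i <= B) -> root p z -> cmod z <= 1 + n%:R * B.
Proof.
move=> pm sp hB /eqP.
have B0 : 0 <= B by apply: le_trans (cmod_ge0 p`_0) (hB 0%N).
have nB0 : 0 <= n%:R * B by rewrite mulr_ge0.
rewrite horner_coef sp big_ord_recr /=.
have -> : p`_n = 1 by rewrite -(monicP pm) lead_coefE sp.
rewrite mul1r => h.
have [z1|z1] := leP (cmod z) 1; first by lra.
have : cmod z ^+ n <= \sum_(i < n) B * cmod z ^+ n.-1.
  rewrite -cmodX; have -> : z ^+ n = - \sum_(i < n) p`_i * z ^+ i.
    by apply/eqP; rewrite -addr_eq0 addrC h.
  rewrite cmodN (le_trans (cmod_sum _ _ _)) // ler_sum // => i _.
  rewrite cmodM cmodX ler_pM ?cmod_ge0 ?exprn_ge0 ?cmod_ge0 //.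
  by apply: ler_weXn2l; rewrite ?(ltW z1) // -ltnS prednK // (leq_ltn_trans _ (ltn_ord i)).
rewrite sumr_const card_ord -[_ *+ n]mulr_natl mulrA.
have zp : 0 < cmod z ^+ n.-1 by rewrite exprn_gt0 // (lt_trans _ z1).
case: (posnP n) => [n0|n0].
  rewrite n0 in h |- *; move: h; rewrite big_ord0 add0r expr0 => /eqP.
  by rewrite oner_eq0.
rewrite -{1}(prednK n0) exprS ler_pM2r // => h'; lra.
Qed.

(** At a root z of [p] the value q(z) = (q - p)(z) is small, whereas it is a product of n distances
    from z to roots of [q]; so one of these is below [rho]. Both polynomials vary near [p0], which
    gives one [eta] for all pairs. *)
Lemma roots_close p0 (rho : R) : 0 < rho ->
  exists2 eta : R, 0 < eta & forall p q,
    p \is monic -> size p = n.+1 -> coef_close eta p0 p ->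
    q \is monic -> size q = n.+1 -> coef_close eta p0 q ->
  forall z, root p z -> exists2 w, root q w & cmod (z - w) < rho.
Proof.
move=> rho0.
pose B := 1 + \sum_(i < (size p0)) cmod p0`_i.
have hB i : cmod p0`_i <= B - 1.
  rewrite /B addrC addKr; have [i0|i0] := ltnP i (size p0); last first.
    by rewrite nth_default // cmod0 sumr_ge0 // => j _; exact: cmod_ge0.
  rewrite (bigD1 (Ordinal i0)) //= lerDl sumr_ge0 // => j _; exact: cmod_ge0.
pose L := 1 + n%:R * B.
have L0 : 0 <= L.
  rewrite addr_ge0 // mulr_ge0 // /B addr_ge0 // sumr_ge0 // => j _; exact: cmod_ge0.
pose S := 1 + \sum_(i < n.+1) L ^+ i.
have S0 : 0 < S by rewrite ltr_wpDr // sumr_ge0 // => i _; rewrite exprn_ge0.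
have rn : 0 < rho ^+ n by rewrite exprn_gt0.
(* The bound 1 keeps the coefficients of [p] below [B] and hence its roots below [L]; the other
   bound makes |(q - p)(z)| < rho^n, since [q - p] has coefficients below [2 * eta]. *)
exists (Num.min 1 (rho ^+ n / (2 * S))).
  by rewrite lt_min ltr01 divr_gt0 // mulr_gt0.
set eta := Num.min _ _ => p q pm sp pc qm sq qc z rz.
have eta1 : eta <= 1 by rewrite ge_min lexx.
have eta2 : eta * (2 * S) <= rho ^+ n.
  by rewrite -ler_pdivlMr ?mulr_gt0 // ge_min lexx orbT.
have zL : cmod z <= L.
  apply: root_bound pm sp _ rz => i.
  have := cmod_tri p0`_i p`_i 0; rewrite !subr0 cmodC => h.
  have := hB i; have := pc i; lra.
have qz : cmod q.[z] < rho ^+ n.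
  have -> : q.[z] = (q - p).[z] by rewrite hornerD hornerN (eqP rz) subr0.
  rewrite (@horner_coef_wide _ n.+1); last first.
    by rewrite (leq_trans (size_polyD _ _)) // size_polyN sp sq maxnn.
  apply: le_lt_trans (cmod_sum _ _ _) _.
  have eta0 : 0 < eta by apply: le_lt_trans (pc 0%N); exact: cmod_ge0.
  apply: (@le_lt_trans _ _ (\sum_(i < n.+1) (2 * eta) * L ^+ i)).
    apply: ler_sum => i _; rewrite cmodM cmodX.
    apply: ler_pM; rewrite ?exprn_ge0 ?cmod_ge0 //; last first.
      by apply: lerXn2r; rewrite ?nnegrE ?cmod_ge0.
    rewrite coefB; have := cmod_tri p0`_i q`_i p`_i.
    have := pc i; have := qc i; rewrite (cmodC q`_i p0`_i); lra.
  rewrite -mulr_sumr; apply: lt_le_trans eta2.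
  by rewrite mulrCA -mulrA ltr_pM2l // ltr_pM2l // /S ltrDr ltr01.
have [b qb] := monic_split qm sq.
apply: contrapT => hn.
have : rho ^+ n <= cmod q.[z].
  rewrite qb /prodX horner_prod cmod_prod -[n in rho ^+ n]card_ord -prodr_const.
  apply: ler_prod => j _; rewrite ltW //= hornerXsubC leNgt; apply/negP => h.
  by apply: hn; exists (b j) => //; rewrite qb prodX_root.
by rewrite leNgt qz.
Qed.

(** Each root of [p0] has a root of [q] within d/4. The n roots so found are at least d/2 apart,
    hence distinct, hence all the roots of [q]. *)
Lemma split_simple_open p0 : split_simple p0 ->
  exists2 d : R, 0 < d & exists2 eta : R, 0 < eta &
  forall q, q \is monic -> size q = n.+1 -> coef_close eta p0 q ->
  split_sep d q.
Proof.
case=> b0 p0b ib0; have [d d0 hd] := inj_separated ib0.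
have d4 : 0 < d / 4 by rewrite divr_gt0.
exists (d / 2); first by rewrite divr_gt0.
have [eta eta0 H] := roots_close p0 d4; exists eta => // q qm sq qc.
have hw j : exists w, root q w /\ cmod (b0 j - w) < d / 4.
  have [||i||w rw h] := H p0 q _ _ _ qm sq qc (b0 j) _; last by exists w.
  - by rewrite p0b prodX_monic.
  - by rewrite p0b size_prodX.
  - by rewrite subrr cmod0.
  - by rewrite p0b prodX_root.
have [b hb] := choice hw.
have sb i j : i != j -> d / 2 <= cmod (b i - b j).
  move=> /hd h; have [_ hi] := hb i; have [_ hj] := hb j.
  have := cmod_tri (b i) (b0 i) (b0 j); have := cmod_tri (b j) (b i) (b0 j).
  rewrite (cmodC (b j)); lra.
exists b => //; apply: prodX_eq => //; last by move=> j; have [] := hb j.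
move=> i j bij; apply/eqP/negPn/negP => /sb; rewrite bij subrr cmod0; lra.
Qed.

End Roots.

(** * Lifting homotopies of polynomials to their roots *)

Section Lifting.
Variables (R : realType) (n : nat).
Notation C := (CC R).

Lemma cpoly_close (T : topologicalType) (G : T -> {poly C}) N x (e : R) :
  cpoly G -> (forall y, (size (G y) <= N)%N) -> 0 < e ->
  \forall y \near x, coef_close e (G x) (G y).
Proof.
move=> cG sG e0.
have : \forall y \near x, forall i : 'I_N, cmod ((G x)`_i - (G y)`_i) < e.
  apply: (filter_forall (nbhs_filter x)) => i.
  by have /continuous_cmodP := cG i; apply.
apply: filterS => y hy i; have [iN|iN] := ltnP i N.
  exact: (hy (Ordinal iN)).
by rewrite !nth_default ?subrr ?cmod0 // (leq_trans (sG _)).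
Qed.

Section Family.
Variable G : R * R -> {poly C}.
Hypothesis cG : cpoly G.
Hypothesis sG : forall x, split_simple n (G x).

Let mG x : G x \is monic.
Proof. exact: split_simple_monic (sG x). Qed.

Let szG x : size (G x) = n.+1.
Proof. exact: split_simple_size (sG x). Qed.

Lemma near_coef_close x e : 0 < e -> \forall y \near x, coef_close e (G x) (G y).
Proof. by move=> e0; apply: cpoly_close => // y; rewrite szG. Qed.

Lemma uniform_sep : exists2 d : R, 0 < d &
  forall x, (0 <= x.1 <= 1) /\ (0 <= x.2 <= 1) -> split_sep n d (G x).
Proof.
apply: (@compact_uniform R _ _ _ (@compact_square R)) => x _.
have [d d0 [eta eta0 H]] := split_simple_open (sG x).
exists d => //; near=> y => e e0 ed.
have [b -> hb] : split_sep n d (G y) by apply: H => //; near: y; exact: near_coef_close.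
by exists b => // i j /hb; apply: le_trans; rewrite ltW.
Unshelve. all: by end_near. Qed.

Lemma uniform_steps (rho : R) : 0 < rho -> exists2 e : R, 0 < e &
  forall s t s', 0 <= s <= 1 -> 0 <= t <= 1 -> `|s - s'| < e ->
  forall z, root (G (s, t)) z ->
  exists2 w, root (G (s', t)) w & cmod (z - w) < rho.
Proof.
move=> rho0.
suff [e e0 h] : exists2 e : R, 0 < e & forall x,
    (0 <= x.1 <= 1) /\ (0 <= x.2 <= 1) -> forall s', `|x.1 - s'| < e ->
    forall z, root (G x) z -> exists2 w, root (G (s', x.2)) w & cmod (z - w) < rho.
  by exists e => // s t s' hs ht; exact: (h (s, t)).
apply: (@compact_uniform R _ _ _ (@compact_square R)) => x _.
have [eta eta0 H] := roots_close n (G x) rho0.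
have /nbhs_ballP [/= r r0 hr] := near_coef_close x eta0.
have r2 : 0 < r / 2 by rewrite divr_gt0.
exists (r / 2) => //; near=> y => d d0 dr s' ys' z rz.
have [xy1 xy2] : ball x (r / 2) y by near: y; exact: nbhsx_ballx.
apply: (H (G y)) => //; apply: hr; split=> /=.
- by apply: lt_trans xy1 _; lra.
- by apply: lt_trans xy2 _; lra.
- rewrite /ball /= -(subrKA y.1) (le_lt_trans (ler_normD _ _)) //.
  by rewrite [r]splitr ltrD // (lt_trans ys').
- by apply: lt_trans xy2 _; lra.
Unshelve. all: by end_near. Qed.

(** No path has to be followed: [H s j t] is any root within d/4 of [b j t]. The gap [d] makes it
    unique, and uniqueness makes it continuous. *)
Lemma lift_step (d : R) (b : 'I_n -> R -> C) :
  0 < d -> (forall x, split_sep n d (G x)) ->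
  (forall j, continuous (b j)) ->
  (forall j t, root (G (0, t)) (b j t)) ->
  (forall s t z, root (G (0, t)) z ->
     exists2 w, root (G (s, t)) w & cmod (z - w) < d / 4) ->
  exists H : R -> 'I_n -> R -> C,
  [/\ forall j, continuous (fun x : R * R => H x.1 j x.2),
      forall s j t, root (G (s, t)) (H s j t) &
      forall s j t, cmod (b j t - H s j t) < d / 4].
Proof.
move=> d0 sepG cb rb step.
have hw (a : R * 'I_n * R) : exists w, root (G (a.1.1, a.2)) w /\
    cmod (b a.1.2 a.2 - w) < d / 4.
  by have [w rw h] := step a.1.1 a.2 _ (rb a.1.2 a.2); exists w.
have [h hh] := choice hw.
exists (fun s j t => h (s, j, t)); split=> [j|s j t|s j t]; last 2 first.
- by have [] := hh (s, j, t).
- by have [] := hh (s, j, t).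
apply/continuous_cmodP => x e e0.
have x_eta : x = (x.1, x.2) by case: x.
have [rx hx] := hh (x.1, j, x.2); rewrite /= in rx hx.
(* The selected root at [y] and the root [w] near the one at [x] are joined through [b j y.2] and
   [b j x.2] by four steps below d/4, so they coincide. *)
pose rho := Num.min e (d / 4).
have rho0 : 0 < rho by rewrite lt_min e0 divr_gt0.
have [eta eta0 H] := roots_close n (G x) rho0.
near=> y.
have [w rw xw] : exists2 w, root (G y) w & cmod (h (x.1, j, x.2) - w) < rho.
  apply: (H (G x)) => //.
  - by move=> i; rewrite subrr cmod0.
  - by near: y; exact: near_coef_close.
  - by rewrite x_eta.
have [] := hh (y.1, j, y.2); rewrite -surjective_pairing /= => ry hy.
have xy : cmod (b j x.2 - b j y.2) < d / 4.
  near: y; have /continuous_cmodP : continuous (fun x : R * R => b j x.2).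
    by apply: (continuous_compose _ (cb j)) => z; exact: cvg_snd.
  by apply; rewrite divr_gt0.
move: xw; rewrite lt_min => /andP[xw1 xw2].
suff <- : w = h (y.1, j, y.2) by [].
apply: split_sepE (sepG y) rw ry _.
have := cmod_tri (b j y.2) w (h (y.1, j, y.2)).
have := cmod_tri (b j x.2) w (b j y.2).
have := cmod_tri (h (x.1, j, x.2)) w (b j x.2).
rewrite (cmodC w (h _)) (cmodC (h _) (b j x.2)); lra.
Unshelve. all: by end_near. Qed.

End Family.

(* Successive steps are glued by adding the increments, each frozen outside its
   own parameter interval, so that continuity is immediate. *)
Lemma lift_homotopy (G : R * R -> {poly C}) (b : 'I_n -> R -> C) :
  cpoly G ->
  (forall s t, 0 <= s <= 1 -> 0 <= t <= 1 -> split_simple n (G (s, t))) ->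
  (forall j, continuous (b j)) ->
  (forall j t, 0 <= t <= 1 -> root (G (0, t)) (b j t)) ->
  (forall t, 0 <= t <= 1 -> injective (b^~ t)) ->
  exists H : R -> 'I_n -> R -> C,
  [/\ forall j, continuous (fun x : R * R => H x.1 j x.2),
      forall s j t, 0 <= s <= 1 -> 0 <= t <= 1 -> root (G (s, t)) (H s j t),
      forall s t, 0 <= s <= 1 -> 0 <= t <= 1 -> injective ((H s)^~ t),
      forall j t, 0 <= t <= 1 -> H 0 j t = b j t &
      forall t, 0 <= t <= 1 ->
        (forall s, 0 <= s <= 1 -> G (s, t) = G (0, t)) ->
        forall s j, 0 <= s <= 1 -> H s j t = b j t].
Proof.
move=> cG sG cb rb ib.
(* Clamping both variables makes the gap [d] valid on the whole plane, as [lift_step] requires. *)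
pose G' (x : R * R) := G (clamp x.1, clamp x.2).
have cG' : cpoly G'.
  apply: (cpoly_compose _ cG); apply: continuous_pair; apply: continuous_clamp.
    by move=> z; exact: cvg_fst.
  by move=> z; exact: cvg_snd.
have sG' x : split_simple n (G' x) by apply: sG; exact: clamp01.
have [d d0 sepd] := uniform_sep cG' sG'.
have sepd' x : split_sep n d (G' x).
  have -> : G' x = G' (clamp x.1, clamp x.2) by rewrite /G' /= !clampK.
  by apply: sepd; rewrite /= !clamp01.
have d4 : 0 < d / 4 by rewrite divr_gt0.
have [e e0 step] := uniform_steps cG' sG' d4.
pose b' j t := b j (clamp t).
have cb' j : continuous (b' j).
  apply: (continuous_compose _ (cb j)); apply: continuous_clamp => z; exact: cvg_id.
have main k : exists H : R -> 'I_n -> R -> C,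
  [/\ forall j, continuous (fun x : R * R => H x.1 j x.2),
      forall s j t, root (G' (Num.min s (k%:R * (e / 2)), t)) (H s j t),
      forall s t, injective ((H s)^~ t),
      forall j t, H 0 j t = b' j t &
      forall t, (forall s, G' (s, t) = G' (0, t)) ->
        forall s j, H s j t = b' j t].
  elim: k => [|k [H [cH rH iH H0 Hc]]].
    exists (fun _ => b'); split=> //.
    - by move=> j; apply: (continuous_compose _ (cb' j)) => z; exact: cvg_snd.
    - move=> s j t; rewrite mul0r.
      have -> : G' (Num.min s 0, t) = G (0, clamp t).
        rewrite /G' /=; congr (G (_, _)).
        by rewrite /clamp; apply/max_idPl; rewrite ge_min ge_min lexx !orbT.
      by apply: rb; exact: clamp01.
    - by move=> _ t; apply: ib; exact: clamp01.
  pose sk : R := k%:R * (e / 2).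
  have e2 : 0 < e / 2 by rewrite divr_gt0.
  have sk0 : 0 <= sk by rewrite mulr_ge0 // ltW.
  have skS : k.+1%:R * (e / 2) = sk + e / 2 by rewrite -natr1 mulrDl mul1r.
  pose cl (s : R) := sk + Num.max 0 (Num.min (e / 2) s).
  have cl_near s : `|sk - cl s| < e.
    rewrite /cl opprD addNKr normrN ger0_norm ?le_max ?lexx //.
    by rewrite gt_max e0 gt_min; apply/orP; left; lra.
  have cl0 s : s <= 0 -> cl s = sk.
    move=> s0; rewrite /cl (_ : Num.max _ _ = 0) ?addr0 //.
    by apply/max_idPl; rewrite ge_min s0 orbT.
  pose Gk (x : R * R) := G' (cl x.1, x.2).
  have cGk : cpoly Gk.
    apply: (cpoly_compose _ cG'); apply: continuous_pair.
      apply: continuous_add; first exact: continuous_const.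
      apply: continuous_maxr; first exact: continuous_const.
      apply: continuous_minr; first exact: continuous_const.
      by move=> z; exact: cvg_fst.
    by move=> z; exact: cvg_snd.
  pose bk j t := H sk j t.
  have cbk j : continuous (bk j).
    apply: (continuous_compose (f := fun t : R => (sk, t)) _ (cH j)).
    apply: continuous_pair; first exact: continuous_const.
    by move=> z; exact: cvg_id.
  have rbk j t : root (Gk (0, t)) (bk j t).
    by rewrite /Gk /= cl0 //; have := rH sk j t; rewrite minxx.
  have stepk s t z : root (Gk (0, t)) z ->
      exists2 w, root (Gk (s, t)) w & cmod (z - w) < d / 4.
    rewrite /Gk /= cl0 // => rz.
    have -> : G' (cl s, t) = G' (clamp (cl s), clamp t) by rewrite /G' /= !clampK.
    apply: (step (clamp sk)); rewrite ?clamp01 //.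
      by rewrite (le_lt_trans (clamp_lip _ _)).
    by have -> : G' (clamp sk, clamp t) = G' (sk, t) by rewrite /G' /= !clampK.
  have [h [ch rh hb]] := lift_step cGk (fun _ => sG' _) d0 (fun _ => sepd' _) cbk rbk stepk.
  have h0 s j t : s <= 0 -> h s j t = bk j t.
    move=> s0; have := rh s j t; rewrite /Gk /= cl0 // => r1.
    have := rbk j t; rewrite /Gk /= cl0 // => r2.
    apply: split_sepE (sepd' (sk, t)) r1 r2 _.
    by rewrite cmodC (lt_trans (hb s j t)) //; lra.
  exists (fun s j t => H (Num.min s sk) j t + h (s - sk) j t - bk j t); split.
  - move=> j; apply: continuous_sub; last first.
      by apply: (continuous_compose _ (cbk j)) => z; exact: cvg_snd.
    apply: continuous_add.
      apply: (continuous_compose (f := fun x : R * R => (Num.min x.1 sk, x.2)) _ (cH j)).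
      apply: continuous_pair; last by move=> z; exact: cvg_snd.
      apply: continuous_minr; last exact: continuous_const.
      by move=> z; exact: cvg_fst.
    apply: (continuous_compose (f := fun x : R * R => (x.1 - sk, x.2)) _ (ch j)).
    apply: continuous_pair; last by move=> z; exact: cvg_snd.
    apply: continuous_sub; last exact: continuous_const.
    by move=> z; exact: cvg_fst.
  - move=> s j t; rewrite skS; case/orP: (le_total s sk) => hs.
      rewrite (min_idPl hs) h0 ?subr_le0 // addrK.
      rewrite (min_idPl _) ?(le_trans hs) ?lerDl ?(ltW e2) //.
      by have := rH s j t; rewrite (min_idPl hs).
    rewrite (min_idPr hs) addrAC subrr add0r.
    have := rh (s - sk) j t; rewrite /Gk /cl /=.
    rewrite (max_idPr _); last by rewrite le_min (ltW e2) subr_ge0.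
    by rewrite minC addr_minr addrC subrK.
  - move=> s t i j /=; case/orP: (le_total s sk) => hs.
      by rewrite (min_idPl hs) !h0 ?subr_le0 // !addrK => /iH.
    (* Strands that meet would start the step from two roots less than d/2 apart. *)
    rewrite (min_idPr hs) !(addrAC _ _ (- bk _ _)) !subrr !add0r => hij.
    apply: (iH sk t); apply: split_sepE (sepd' (sk, t)) _ _ _.
    + by have := rbk i t; rewrite /Gk /= cl0.
    + by have := rbk j t; rewrite /Gk /= cl0.
    + have := hb (s - sk) i t; have := hb (s - sk) j t.
      rewrite hij (cmodC (bk j t)).
      have := cmod_tri (h (s - sk) j t) (bk i t) (bk j t); lra.
  - by move=> j t; rewrite (min_idPl sk0) H0 h0 ?sub0r ?oppr_le0 // addrK.
  (* Where the family does not depend on [s], the old and the new root belong to one polynomial and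
     are closer than [d]. *)
  - move=> t Gt s j; rewrite Hc //.
    suff -> : h (s - sk) j t = bk j t by rewrite addrK.
    have := rh (s - sk) j t; rewrite /Gk /= Gt => r1.
    have := rbk j t; rewrite /Gk /= Gt => r2.
    apply: split_sepE (sepd' _) r1 r2 _.
    by rewrite cmodC (lt_trans (hb _ j t)) //; lra.
have [k hk] : exists k : nat, 1 <= k%:R * (e / 2).
  exists (Num.truncn (e / 2)^-1).+1.
  by rewrite -ler_pdivrMr ?divr_gt0 // mul1r ltW // truncnS_gt.
have [H [cH rH iH H0 Hc]] := main k.
exists H; split=> //.
- move=> s j t hs ht; have := rH s j t; rewrite (min_idPl _); last first.
    by apply: le_trans hk; case/andP: hs.
  by rewrite /G' /= !clampE.
- by move=> j t ht; rewrite H0 /b' clampE.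
- move=> t ht Gt s j hs; rewrite Hc ?/b' ?clampE // => s'.
  by rewrite /G' /= clamp0 (clampE ht) Gt ?clamp01.
Qed.

End Lifting.

(** * Genericity as the non-vanishing of a polynomial *)

Section Generic.
Variable R : realType.
Notation C := (CC R).

Lemma split_simpleI n (p : {poly C}) : p \is monic -> size p = n.+1 ->
  (forall z, root p z -> ~~ root p^`() z) -> split_simple n p.
Proof.
move=> pm sp h; have [b pb] := monic_split pm sp; exists b => // i j bij.
apply/eqP/negPn/negP => ij.
have := h (b i); rewrite pb prodX_root => /(_ isT)/negP; apply.
rewrite /prodX (bigD1 i) //= (bigD1 j) 1?eq_sym //= -bij.
by rewrite /root !derivE !(hornerE, subrr, mul0r, mulr0, mul1r, add0r, addr0).
Qed.

Lemma split_simple_deriv n (p : {poly C}) z :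
  split_simple n p -> root p z -> ~~ root p^`() z.
Proof.
move=> [b -> ib] /root_prodX[i ->]; rewrite /prodX (bigD1 i) //=.
rewrite /root !derivE !(hornerE, subrr, mul0r, mulr0, mul1r, add0r, addr0) /=.
rewrite horner_prod; apply/prodf_neq0 => j ji.
by rewrite hornerXsubC subr_eq0; apply: contra_neq ji => /ib.
Qed.

Definition generic m (Q : {poly C}) := exists2 xi : 'I_m -> C,
  forall i, root Q^`() (xi i) & injective (fun i => Q.[xi i]).

Section Krylov.
Variables (A : comNzRingType) (m D : nat).

(** The ring [A] is kept general so that one determinant over [{poly C}] can treat a whole line of
    polynomials. *)
Definition krylov_row (Q : {poly A}) i : {poly A} :=
  if (i < m)%N then Q ^+ i else 'X^(i - m) * Q^`().

(* Invertible iff the powers of [Q] span [A[X] / (Q')], which, over an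
   algebraically closed field, says that Q takes m distinct values on the
   roots of [Q']. *)
Definition krylov (Q : {poly A}) : 'M[A]_D :=
  \matrix_(i, j) (krylov_row Q i)`_j.

End Krylov.

Lemma map_krylov (A B : comNzRingType) (f : {rmorphism A -> B}) m D Q :
  map_mx f (krylov m D Q) = krylov m D (map_poly f Q).
Proof.
apply/matrixP => i j; rewrite !mxE /krylov_row.
case: ifP => _; rewrite -coef_map; first by rewrite rmorphXn.
by rewrite rmorphM /= map_polyXn deriv_map.
Qed.

Section Criterion.
Variables (m : nat) (Q : {poly C}).
Hypotheses (Qm : Q \is monic) (sQ : size Q = m.+2).
(** Large enough for the degrees of Q^i with i < m, while X^(i-m) Q' has degree exactly i. The
    summand 2 ensures that column 1 exists, even for m = 0. *)
Let D := (m.+1 * m + 2)%N.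

Lemma size_deriv_monic : size Q^`() = m.+1.
Proof.
have Q0 : Q != 0 by exact: monic_neq0.
apply/eqP; rewrite eqn_leq; apply/andP; split.
  by rewrite -ltnS -sQ; exact: lt_size_deriv.
rewrite ltnNge; apply/negP => /leq_sizeP/(_ m (leqnn m)).
have := monicP Qm; rewrite lead_coefE sQ /= coef_deriv => -> /eqP.
by rewrite pnatr_eq0.
Qed.

Lemma size_krylov_row (i : 'I_D) : (size (krylov_row m Q i) <= D)%N.
Proof.
have iD := ltn_ord i; rewrite /krylov_row; case: ltnP => im.
  apply: (leq_trans (size_poly_exp_leq _ _)); rewrite sQ /=.
  have : (m.+1 * i <= m.+1 * m)%N by rewrite leq_mul2l ltnW.
  by move=> /leq_ltn_trans; apply; rewrite /D addn2.
apply: (leq_trans (size_polyMleq _ _)); rewrite size_polyXn size_deriv_monic.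
by rewrite addnS /= addSn -ltnS ltnS subnK.
Qed.

Lemma krylov_horner z (i : 'I_D) :
  \sum_(j < D) krylov m D Q i j * z ^+ j = (krylov_row m Q i).[z].
Proof.
rewrite (horner_coef_wide _ (size_krylov_row i)).
by apply: eq_bigr => j _; rewrite mxE.
Qed.

Lemma krylov_deriv z (i : 'I_D) :
  \sum_(j < D) krylov m D Q i j * (z ^+ j.-1 *+ j) = (krylov_row m Q i)^`().[z].
Proof.
under eq_bigr do rewrite mxE.
move: (krylov_row _ _ _) (size_krylov_row i) => g sz.
have {2}-> : g = \sum_(j < D) g`_j *: 'X^j.
  apply/polyP => k; rewrite -poly_def coef_poly.
  by case: ltnP => // /(leq_trans sz) h; rewrite nth_default.
rewrite raddf_sum horner_sum; apply: eq_bigr => j _.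
by rewrite /= derivZ derivXn !hornerE hornerMn hornerXn.
Qed.

(** Each failure of genericity yields a kernel vector with nonzero entry 1. At a double root z of Q'
    it is the derivative of the column (z^j), because all rows have zero derivative there; for two
    critical points with the same value it is the difference of their columns. *)
Lemma krylov_generic : \det (krylov m D Q) != 0 -> generic m Q.
Proof.
move=> dK; have uK : krylov m D Q \in unitmx by rewrite unitmxE unitfE.
have ker0 (c : 'cV[C]_D) : krylov m D Q *m c = 0 -> c = 0.
  by move=> h; rewrite -(mulKmx uK c) h mulmx0.
have D1 : (1 < D)%N by rewrite /D addn2.
have n0 : (m.+1%:R : C) != 0 by rewrite pnatr_eq0.
pose f := (m.+1%:R)^-1 *: Q^`().
have rf z : root f z = root Q^`() z by rewrite rootZ // invr_eq0.
have lcQ' : lead_coef Q^`() = m.+1%:R.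
  rewrite lead_coefE size_deriv_monic coef_deriv.
  by have := monicP Qm; rewrite lead_coefE sQ => ->.
have [xi fxi ixi] : split_simple m f.
  apply: split_simpleI.
  - by rewrite monicE lead_coefZ lcQ' mulVf.
  - by rewrite size_scale ?invr_eq0 // size_deriv_monic.
  - move=> z; rewrite rf => rz; rewrite derivZ rootZ ?invr_eq0 //.
    apply/negP => rz'.
    pose c : 'cV[C]_D := \col_j (z ^+ j.-1 *+ j).
    have /matrixP/(_ (Ordinal D1) 0) : c = 0.
      apply: ker0; apply/matrixP => i k; rewrite !mxE.
      under eq_bigr do rewrite [c _ _]mxE.
      rewrite krylov_deriv /krylov_row; case: ifP => _.
        by rewrite deriv_exp hornerMn hornerM (eqP rz) mul0r mul0rn.
      by rewrite derivM hornerD !hornerM (eqP rz) (eqP rz') !mulr0 addr0.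
    by rewrite !mxE /= expr0 => /eqP; rewrite oner_eq0.
have rxi i : root Q^`() (xi i) by rewrite -rf fxi prodX_root.
exists xi => // i j Qij; apply: ixi.
pose c : 'cV[C]_D := \col_k (xi i ^+ k - xi j ^+ k).
have /matrixP/(_ (Ordinal D1) 0) : c = 0.
  apply: ker0; apply/matrixP => k l; rewrite !mxE.
  under eq_bigr do rewrite [c _ _]mxE mulrBr.
  rewrite sumrB !krylov_horner /krylov_row; case: ifP => _.
    by rewrite !horner_exp Qij subrr.
  by rewrite !hornerM !(eqP (rxi _)) !mulr0 subrr.
by rewrite !mxE /= !expr1 => /eqP; rewrite subr_eq0 => /eqP.
Qed.

(** A left kernel vector is a relation a(Q) + h Q' = 0 with deg a < m. Evaluated at the critical
    points, it makes [a] vanish at m distinct values, so a = 0 and then h = 0. *)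
Lemma generic_krylov : generic m Q -> \det (krylov m D Q) != 0.
Proof.
move=> [xi rxi ixi]; apply/negP => /det0P[v v0 vK].
have mD : (m <= D)%N by rewrite /D addn2 leqW // leqW // leq_pmull.
have DS : D = D.-1.+1 by rewrite /D addn2.
(* [v] extended by zero to all naturals, so that the sum over rows can be cut at [m]. *)
pose vv i := if insub i is Some k then v 0 k else 0.
have vvE (i : 'I_D) : vv i = v 0 i by rewrite /vv valK.
pose a := \poly_(i < m) vv i.
pose h := \poly_(i < D - m) vv (i + m)%N.
have E : (a \Po Q) + h * Q^`() = 0.
  transitivity (\sum_(i < D) v 0 i *: krylov_row m Q i); last first.
    apply/polyP => j; rewrite coef0 coef_sum.
    have [jD|jD] := ltnP j D; last first.
      apply: big1 => i _; rewrite coefZ nth_default ?mulr0 //.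
      exact: leq_trans (size_krylov_row i) jD.
    have /matrixP/(_ 0 (Ordinal jD)) := vK; rewrite [LHS]mxE [RHS]mxE => H.
    rewrite -[RHS]H.
    by apply: eq_bigr => i _; rewrite coefZ !mxE.
  under [RHS]eq_bigr do rewrite -vvE.
  rewrite -(big_mkord xpredT (fun i => vv i *: krylov_row m Q i)).
  rewrite (big_cat_nat (leq0n m) mD) //=; congr (_ + _).
    rewrite /a poly_def raddf_sum big_mkord; apply: eq_bigr => i _ /=.
    by rewrite comp_polyZ comp_Xn_poly /krylov_row ltn_ord.
  rewrite /h poly_def mulr_suml -[X in \sum_(X <= _ < _) _]add0n big_addn big_mkord.
  apply: eq_bigr => i _.
  by rewrite /krylov_row ltnNge leq_addl /= addnK scalerAl.
have a0 : a = 0.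
  apply: (@roots_geq_poly_eq0 _ _ [seq Q.[xi i] | i <- enum 'I_m]).
  - apply/allP => _ /mapP[i _ ->]; rewrite /root -horner_comp.
    have := congr1 (horner^~ (xi i)) E; rewrite hornerD hornerM (eqP (rxi i)).
    by rewrite mulr0 addr0 horner0 => ->.
  - by rewrite map_inj_uniq // enum_uniq.
  - by rewrite size_map size_enum_ord size_poly.
have h0 : h = 0.
  move: E; rewrite a0 comp_poly0 add0r => /eqP; rewrite mulf_eq0 => /orP[/eqP//|].
  by rewrite -size_poly_eq0 size_deriv_monic.
case/negP: v0; apply/eqP/matrixP => k i; rewrite ord1 mxE -vvE.
have [im|im] := ltnP i m.
  by have := congr1 (fun p : {poly C} => p`_i) a0; rewrite coef_poly im coef0.
have := congr1 (fun p : {poly C} => p`_(i - m)) h0.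
by rewrite coef_poly coef0 ltn_sub2r ?subnK // (leq_ltn_trans im).
Qed.

End Criterion.

(** [QQ] is the whole line at once, with its parameter as the inner indeterminate; evaluation at [u]
    commutes with the determinant. *)
Lemma generic_line m (b d : 'I_m.+1 -> C) :
  exists S : {poly C},
  forall u, S.[u] != 0 <-> generic m (prodX (fun j => b j + u * d j)).
Proof.
pose D := (m.+1 * m + 2)%N.
pose QQ : {poly {poly C}} := \prod_j ('X - ((b j)%:P + 'X * (d j)%:P)%:P).
exists (\det (krylov m D QQ)) => u.
have -> : (\det (krylov m D QQ)).[u] =
    \det (krylov m D (prodX (fun j => b j + u * d j))).
  rewrite -[LHS]/(horner_eval u _) -det_map_mx map_krylov; congr (\det (krylov _ _ _)).
  rewrite rmorph_prod; apply: eq_bigr => j _.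
  by rewrite rmorphB /= map_polyX map_polyC /= /horner_eval !hornerE.
by split; [apply: krylov_generic|apply: generic_krylov];
  rewrite ?prodX_monic ?size_prodX.
Qed.

Lemma poly_roots (S : {poly C}) : S != 0 -> exists rs : seq C,
  forall z, (z \in rs) = root S z.
Proof.
move=> S0; have [rs SE] := closed_field_poly_normal S.
exists rs => z; rewrite SE rootZ ?lead_coef_eq0 //.
by rewrite root_prod_XsubC.
Qed.

Lemma small_notin (l : seq R) (e : R) : 0 < e ->
  exists2 a : R, 0 < a < e & a \notin l.
Proof.
move=> e0; have [d d0 hd] : exists2 d : R, 0 < d & forall x, x \in l -> 0 < x -> d <= x.
  elim: l => [|y l [d d0 IH]]; first by exists 1.
  have [y0|y0] := ltP 0 y; last first.
    by exists d => // x; rewrite inE => /orP[/eqP -> /(le_lt_trans y0)|/IH//]; rewrite ltxx.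
  exists (Num.min d y); first by rewrite lt_min d0.
  move=> x; rewrite inE ge_min => /orP[/eqP ->|/IH h /h -> //]; by rewrite lexx orbT.
exists (Num.min d e / 2).
  rewrite divr_gt0 ?lt_min ?d0 //= ltr_pdivrMr // gt_min; apply/orP; right; lra.
apply/negP => /hd; rewrite divr_gt0 ?lt_min ?d0 // => /(_ isT).
rewrite ler_pdivlMr // le_min => /andP[h _]; lra.
Qed.

(* A point z lies on at most one of the arcs [u_a(x) = x + i a x (1 - x)]. *)
Lemma avoiding_path (rs : seq C) : 0 \notin rs -> 1 \notin rs ->
  exists u : R -> C, [/\ continuous u, u 0 = 0, u 1 = 1 &
    forall x, 0 <= x <= 1 -> u x \notin rs /\ cmod (u x) <= 2].
Proof.
move=> r0 r1.
(* A point z on the arc forces x = Re z and determines [a] by this quotient, so finitely many values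
   of [a] are excluded; a < 1 gives the bound 2 below. *)
have [a /andP[a0 a1] ha] := @small_notin
  [seq complex.Im z / (complex.Re z * (1 - complex.Re z)) | z <- rs] 1 ltr01.
pose u (x : R) : C := (x%:C + 'i * (a * x * (1 - x))%:C)%C.
have u0 : u 0 = 0 by rewrite /u mulr0 mul0r rmorph0 mulr0 addr0.
have u1 : u 1 = 1 by rewrite /u subrr mulr0 rmorph0 mulr0 addr0.
have cid : continuous (fun x : R => x) by move=> x; exact: cvg_id.
exists u; split=> //.
  apply: continuous_add; first exact: continuous_real.
  apply: continuous_mul; first exact: continuous_const.
  apply: continuous_real; apply: continuous_mul.
    by apply: continuous_mul => //; exact: continuous_const.
  by apply: continuous_sub => //; exact: continuous_const.
move=> x /andP[x0 x1]; split.
  have [->|xn0] := eqVneq x 0; first by rewrite u0.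
  have [->|xn1] := eqVneq x 1; first by rewrite u1.
  apply: contra ha => ux; apply/mapP; exists (u x) => //.
  have -> : complex.Re (u x) = x by rewrite /u /=; ring.
  have -> : complex.Im (u x) = a * x * (1 - x) by rewrite /u /=; ring.
  field; by rewrite xn0 subr_eq0 eq_sym xn1.
rewrite /u (le_trans (cmodD _ _)) // cmodM !cmod_real.
have -> : cmod ('i%C : C) = 1 by rewrite /cmod normc_def /= expr0n expr1n add0r sqrtr1.
rewrite mul1r ger0_norm // ger0_norm; last by rewrite !mulr_ge0 ?subr_ge0 // ltW.
have ax : a * x <= 1 by rewrite mulr_ile1 // ltW.
have axx : a * x * (1 - x) <= 1.
  by rewrite mulr_ile1 ?mulr_ge0 ?subr_ge0 // ?(ltW a0) //; lra.
lra.
Qed.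

End Generic.

(** * Generic perturbations and the motion of critical values *)

Section Perturbation.
Variables (R : realType) (m : nat).
Notation C := (CC R).

(** The line from [b] through the generic [g] has only finitely many bad parameters, so some
    arbitrarily small real parameter is good. *)
Lemma generic_dense (b g : 'I_m.+1 -> C) (e : R) : 0 < e ->
  generic m (prodX g) -> exists2 p : 'I_m.+1 -> C, generic m (prodX p) &
  forall j, cmod (p j - b j) < e.
Proof.
move=> e0 gg; have [S hS] := generic_line b (fun j => g j - b j).
have S0 : S != 0.
  have : S.[1] != 0.
    apply/hS; suff -> : (fun j => b j + 1 * (g j - b j)) = g by [].
    by apply/funext => j; rewrite mul1r subrKC.
  by apply: contra_neq => ->; rewrite horner0.
have [rs hrs] := poly_roots S0.
pose L := 1 + \sum_(j < m.+1) cmod (g j - b j).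
have sum0 : 0 <= \sum_(j < m.+1) cmod (g j - b j).
  by apply: sumr_ge0 => j _; exact: cmod_ge0.
have L0 : 0 < L by rewrite ltr_wpDr.
have [a /andP[a0 ae] ha] := small_notin [seq complex.Re z | z <- rs] (divr_gt0 e0 L0).
exists (fun j => b j + a%:C%C * (g j - b j)).
  apply/hS; rewrite -/(root S _) -hrs; apply: contra ha => h.
  by apply/mapP; exists (a%:C%C).
move=> j; rewrite addrC addKr cmodM cmod_real gtr0_norm //.
move: ae; rewrite ltr_pdivlMr // => /(le_lt_trans _); apply.
rewrite ler_pM2l // /L (bigD1 j) //= addrCA lerDl addr_ge0 //.
by apply: sumr_ge0 => i _; exact: cmod_ge0.
Qed.

(** Finitely many bad parameters do not separate 0 from 1 in the complex plane of parameters. The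
    bound 2 keeps the path close to [p] when [q] is close to it. *)
Lemma generic_path (p q : 'I_m.+1 -> C) :
  generic m (prodX p) -> generic m (prodX q) ->
  exists u : R -> C, [/\ continuous u, u 0 = 0, u 1 = 1 &
    forall x, 0 <= x <= 1 -> generic m (prodX (fun j => p j + u x * (q j - p j)))
      /\ cmod (u x) <= 2].
Proof.
move=> gp gq; have [S hS] := generic_line p (fun j => q j - p j).
have S0 : S.[0] != 0.
  apply/hS; suff -> : (fun j => p j + 0 * (q j - p j)) = p by [].
  by apply/funext => j; rewrite mul0r addr0.
have S1 : S.[1] != 0.
  apply/hS; suff -> : (fun j => p j + 1 * (q j - p j)) = q by [].
  by apply/funext => j; rewrite mul1r subrKC.
have [rs hrs] : exists rs : seq C, forall z, (z \in rs) = root S z.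
  by apply: poly_roots; apply: contra_neq S0 => ->; rewrite horner0.
have [||u [cu u0 u1 hu]] := @avoiding_path R rs; rewrite ?hrs //.
exists u; split=> // x /hu[h ux]; split=> //; apply/hS.
by rewrite hrs in h.
Qed.

Lemma perturb_generic (b : 'I_m.+1 -> R -> C) (rho : R) : 0 < rho ->
  (forall j, continuous (b j)) ->
  generic m (prodX (b^~ 0)) -> generic m (prodX (b^~ 1)) ->
  exists c : 'I_m.+1 -> R -> C,
  [/\ forall j, continuous (c j),
      forall t, 0 <= t <= 1 -> generic m (prodX (c^~ t)),
      forall j t, 0 <= t <= 1 -> cmod (c j t - b j t) < rho,
      forall j, c j 0 = b j 0 & forall j, c j 1 = b j 1].
Proof.
move=> rho0 cb g0 g1.
(* Consecutive nodes differ by less than 3e and [u] is at most 2, so the path leaves a node by less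
   than 6e; the node is within e of [b], which itself moves by less than e. *)
pose e := rho / 8; have e0 : 0 < e by rewrite divr_gt0.
have [d d0 hd] := continuous_uniform01 e0 cb.
pose N := (Num.truncn d^-1).+1.
have N0 : 0 < N%:R :> R by rewrite ltr0n.
pose h : R := N%:R^-1.
have h0 : 0 < h by rewrite invr_gt0.
have hdl : h < d by rewrite /h invf_plt ?posrE // truncnS_gt.
have Nh : N%:R * h = 1 by rewrite /h divff // gt_eqF.
(* The last node [p] is prescribed, so that the final one can be the given end of [b]; the clause
   for k = 0 fixes the start. *)
have main k : (k <= N)%N -> forall p, generic m (prodX p) ->
    (forall j, cmod (p j - b j (k%:R * h)) < e) ->
    (k = 0%N -> p = b^~ 0) ->
  exists c : 'I_m.+1 -> R -> C,
  [/\ forall j, continuous (c j),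
      forall t, 0 <= t <= k%:R * h -> generic m (prodX (c^~ t)),
      forall j t, 0 <= t <= k%:R * h -> cmod (c j t - b j t) < rho,
      forall j, c j 0 = b j 0 & forall j, c j (k%:R * h) = p j].
  elim: k => [|k IH] kN p gp pb p0.
    exists (fun j _ => p j); split.
    - by move=> j; exact: continuous_const.
    - by move=> t _; exact: gp.
    - move=> j t; rewrite mul0r -eq_le => /eqP <-.
      by rewrite (p0 erefl) subrr cmod0.
    - by move=> j; rewrite (p0 erefl).
    - by [].
  pose tk : R := k%:R * h.
  have tk0 : 0 <= tk by rewrite mulr_ge0 // ltW.
  have tkS : k.+1%:R * h = tk + h by rewrite -natr1 mulrDl mul1r.
  have tk1 : tk + h <= 1 by rewrite -tkS -[leRHS]Nh ler_pM2r // ler_nat.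
  have [q gq [qb q0]] : exists2 q, generic m (prodX q) &
      (forall j, cmod (q j - b j tk) < e) /\ (k = 0%N -> q = b^~ 0).
    have [k0|k0] := posnP k.
      exists (b^~ 0) => //; split=> // j.
      by rewrite /tk k0 mul0r subrr cmod0.
    have [q gq hq] := generic_dense (b^~ tk) e0 g0.
    by exists q => //; split=> // k0'; rewrite k0' in k0.
  have [c [cc gc hc c0 cq]] := IH (ltnW kN) q gq qb q0.
  have [u [cu u0 u1 hu]] := generic_path gq gp.
  pose x (t : R) := clamp ((t - tk) * N%:R).
  have cx : continuous x.
    apply: continuous_clamp; apply: continuous_mul; last exact: continuous_const.
    by apply: continuous_sub; [exact: continuous_ident|exact: continuous_const].
  have x_low t : t <= tk -> x t = 0.
    move=> ht; rewrite /x; apply/max_idPl; rewrite ge_min; apply/orP; right.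
    by rewrite mulr_le0_ge0 ?subr_le0 // ltW.
  pose c' j t := c j (Num.min t tk) + u (x t) * (p j - q j).
  have c'low j t : t <= tk -> c' j t = c j t.
    by move=> ht; rewrite /c' x_low // u0 mul0r addr0 (min_idPl ht).
  have c'high j t : tk <= t -> c' j t = q j + u (x t) * (p j - q j).
    by move=> ht; rewrite /c' (min_idPr ht) cq.
  exists c'; rewrite tkS; split.
  - move=> j; apply: continuous_add.
      apply: (continuous_compose _ (cc j)); apply: continuous_minr.
        exact: continuous_ident.
      exact: continuous_const.
    apply: continuous_mul; last exact: continuous_const.
    exact: (continuous_compose cx cu).
  - move=> t /andP[t0 t1]; case/orP: (le_total t tk) => ht.
      have -> : c'^~ t = c^~ t by apply/funext => j; exact: c'low.
      by apply: gc; rewrite t0.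
    have -> : c'^~ t = fun j => q j + u (x t) * (p j - q j).
      by apply/funext => j; exact: c'high.
    by have [] := hu (x t) (clamp01 _).
  - move=> j t /andP[t0 t1]; case/orP: (le_total t tk) => ht.
      by rewrite c'low // hc // t0.
    have tkS01 : 0 <= tk + h <= 1 by rewrite tk1 addr_ge0 // ltW.
    have tk01 : 0 <= tk <= 1 by rewrite tk0 (le_trans _ tk1) // lerDl ltW.
    have t01 : 0 <= t <= 1 by rewrite t0 (le_trans t1).
    have b1 : cmod (b j (tk + h) - b j tk) < e.
      by apply: hd => //; rewrite addrC addKr gtr0_norm.
    have b2 : cmod (b j tk - b j t) < e.
      apply: hd => //; rewrite distrC ger0_norm ?subr_ge0 //.
      by apply: le_lt_trans hdl; rewrite lerBlDl.
    have pq : cmod (p j - q j) < 3 * e.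
      have := pb j; rewrite tkS; have := qb j.
      have := cmod_tri (b j (tk + h)) (p j) (q j).
      have := cmod_tri (b j tk) (b j (tk + h)) (q j).
      rewrite (cmodC (b j tk) (q j)); lra.
    rewrite c'high //.
    have [_ ux] := hu (x t) (clamp01 _).
    have uu : cmod (u (x t) * (p j - q j)) <= 2 * cmod (p j - q j).
      by rewrite cmodM ler_wpM2r // cmod_ge0.
    have := cmod_tri (b j tk) (q j + u (x t) * (p j - q j)) (b j t).
    have := cmodD (q j - b j tk) (u (x t) * (p j - q j)).
    rewrite addrAC; have := qb j.
    have -> : rho = 8 * e by rewrite /e; lra.
    lra.
  - by move=> j; rewrite c'low.
  - move=> j; rewrite c'high; last by rewrite lerDl ltW.
    have -> : x (tk + h) = 1 by rewrite /x addrC addKr mulVf ?clamp1 // gt_eqF.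
    by rewrite u1 mul1r subrKC.
have [||c [cc gc hc c0 c1]] := main N (leqnn N) (b^~ 1) g1.
- by move=> j; rewrite Nh subrr cmod0.
- by [].
by rewrite Nh in gc hc c1; exists c.
Qed.

Lemma generic_deriv (Q : {poly C}) (xi : 'I_m -> C) :
  Q \is monic -> size Q = m.+2 -> (forall i, root Q^`() (xi i)) ->
  injective xi -> m.+1%:R^-1 *: Q^`() = prodX xi.
Proof.
move=> Qm sQ rxi ixi.
have n0 : (m.+1%:R : C) != 0 by rewrite pnatr_eq0.
apply: prodX_eq => //.
- rewrite monicE lead_coefZ lead_coefE (size_deriv_monic Qm sQ) coef_deriv.
  by have := monicP Qm; rewrite lead_coefE sQ => ->; rewrite mulVf.
- by rewrite size_scale ?invr_eq0 // (size_deriv_monic Qm sQ).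
- by move=> i; rewrite rootZ ?invr_eq0.
Qed.

(** Genericity makes the roots of Q' simple, so they can be followed continuously; the punctures are
    the values of [Q] along them. *)
Lemma critical_values_lift (Q : R -> {poly C}) : cpoly Q ->
  (forall t, 0 <= t <= 1 ->
    [/\ Q t \is monic, size (Q t) = m.+2 & generic m (Q t)]) ->
  exists v : 'I_m -> R -> C,
  [/\ forall i, continuous (v i),
      forall t, 0 <= t <= 1 -> injective (v^~ t),
      forall t z, 0 <= t <= 1 -> root (Q t)^`() z -> exists i, (Q t).[z] = v i t &
      forall t i, 0 <= t <= 1 ->
        exists2 z, root (Q t)^`() z & (Q t).[z] = v i t].
Proof.
move=> cQ hQ.
have n0 : (m.+1%:R : C) != 0 by rewrite pnatr_eq0.
have h01 : 0 <= (0 : R) <= 1 by rewrite lexx ler01.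
pose G (x : R * R) := m.+1%:R^-1 *: (Q x.1)^`().
have GE t : 0 <= t <= 1 -> exists xi : 'I_m -> C,
    [/\ m.+1%:R^-1 *: (Q t)^`() = prodX xi, injective xi &
        injective (fun i => (Q t).[xi i])].
  move=> /hQ[Qm sQ [xi rxi ixi]]; exists xi.
  have ixi' : injective xi by move=> i j hij; apply: ixi; rewrite hij.
  by split=> //; exact: generic_deriv.
have rG t z : root (m.+1%:R^-1 *: (Q t)^`()) z = root (Q t)^`() z.
  by rewrite rootZ ?invr_eq0.
have cG : cpoly G.
  apply: cpolyZ; first exact: continuous_const.
  apply: cpoly_deriv; apply: (cpoly_compose _ cQ) => z; exact: cvg_fst.
(* Time is the homotopy parameter of [lift_homotopy]; its strand variable is a dummy, later set to
   0. *)
have [x0 [G0 ix0 _]] := GE 0 h01.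
have [|j|j t _|t _ i j|H [cH rH iH _ _]] :=
    @lift_homotopy R m G (fun i _ => x0 i) cG.
- by move=> s t hs _; rewrite /G /=; have [xi [-> ixi _]] := GE s hs; exists xi.
- exact: continuous_const.
- by rewrite /G /= G0 prodX_root.
- exact: ix0.
pose v i t := (Q (clamp t)).[H t i 0].
have vE i t : 0 <= t <= 1 -> v i t = (Q t).[H t i 0] by move=> ht; rewrite /v clampE.
have HE t : 0 <= t <= 1 -> m.+1%:R^-1 *: (Q t)^`() = prodX (fun i => H t i 0).
  move=> ht; have [Qm sQ _] := hQ t ht; apply: generic_deriv => //.
  - by move=> i; rewrite -rG; exact: (rH t i 0).
  - by apply: (iH t 0).
exists v; split.
- move=> i; apply: (@continuous_horner _ _ _ _ m.+2).
  + by move=> t; have [_ -> _] := hQ _ (clamp01 t).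
  + apply: (cpoly_compose _ cQ); apply: continuous_clamp; exact: continuous_ident.
  + apply: (continuous_compose (f := fun t : R => (t, 0)) _ (cH i)).
    by apply: continuous_pair; [exact: continuous_ident|exact: continuous_const].
- move=> t ht i j; rewrite !vE // => hij; apply: (iH t 0) => //=.
  have [xi [E ixi vxi]] := GE t ht.
  have rk : root (prodX xi) (H t i 0) by rewrite -E; exact: (rH t i 0).
  have [k hk] := root_prodX rk.
  have rl : root (prodX xi) (H t j 0) by rewrite -E; exact: (rH t j 0).
  have [l hl] := root_prodX rl.
  rewrite hk hl in hij *; congr (xi _); exact: vxi.
- move=> t z ht; rewrite -rG (HE t ht) => /root_prodX[i ->].
  by exists i; rewrite vE.
- move=> t i ht; exists (H t i 0); last by rewrite vE.
  by rewrite -rG; exact: (rH t i 0).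
Qed.

End Perturbation.

(** * Dragging a path along with moving punctures *)

Section Transport.
Variables (R : realType) (m : nat).
Notation C := (CC R).

(* Moves the punctures [p i] to [q i] by a tent-shaped displacement supported in
   the discs of radius [r] around them. *)
Definition push (r : R) (p q : 'I_m -> C) (z : C) : C :=
  z + \sum_i (Num.max 0 (1 - cmod (z - p i) / r))%:C%C * (q i - p i).

Lemma push_id r p z : push r p p z = z.
Proof.
by rewrite /push big1 ?addr0 // => i _; rewrite subrr mulr0.
Qed.

Lemma tent_out (r d : R) : 0 < r -> r <= d -> Num.max 0 (1 - d / r) = 0.
Proof. by move=> r0 rd; apply/max_idPl; rewrite subr_le0 ler_pdivlMr // mul1r. Qed.

Lemma push_far r p q z : 0 < r -> (forall i, r <= cmod (z - p i)) ->
  push r p q z = z.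
Proof.
move=> r0 h; rewrite /push big1 ?addr0 // => i _.
by rewrite tent_out // rmorph0 mul0r.
Qed.

(** The discs are disjoint, so at most one displacement acts on [z]. In disc i, at distance d from
    its centre, the new difference to [q i] is (z - p_i) - (d/r)(q_i - p_i), and the second term is
    shorter than d; every other [q j] is too far away. *)
Lemma push_avoid r p q z : 0 < r ->
  (forall i j, i != j -> 4 * r <= cmod (p i - p j)) ->
  (forall i, cmod (p i - q i) < r) -> (forall i, z != p i) ->
  forall j, push r p q z != q j.
Proof.
move=> r0 sp pq zp j; rewrite -subr_eq0 -cmod_gt0.
case: (pickP (fun i => cmod (z - p i) < r)) => [i zi|out]; last first.
  have far i : r <= cmod (z - p i) by rewrite leNgt out.
  rewrite push_far //; have := cmod_tri (q j) z (p j); have := far j.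
  have := pq j; rewrite (cmodC (p j)); lra.
have zero k : k != i -> Num.max 0 (1 - cmod (z - p k) / r) = 0.
  move=> ki; apply: tent_out => //; have := sp _ _ ki.
  have := cmod_tri z (p k) (p i); rewrite (cmodC (p k) z); lra.
have -> : push r p q z = z + (1 - cmod (z - p i) / r)%:C%C * (q i - p i).
  rewrite /push (bigD1 i) //= big1 ?addr0 => [|k ki]; last by rewrite zero // rmorph0 mul0r.
  by rewrite (max_idPr _) // subr_ge0 ler_pdivrMr // mul1r ltW.
set d := cmod (z - p i) in zi *.
have d0 : 0 < d by rewrite cmod_gt0 subr_eq0.
have dr0 : 0 < d / r by rewrite divr_gt0.
have dr1 : d / r < 1 by rewrite ltr_pdivrMr // mul1r.
have [->|ji] := eqVneq j i.
  have -> : z + (1 - d / r)%:C%C * (q i - p i) - q i =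
      (z - p i) - (d / r)%:C%C * (q i - p i).
    by rewrite rmorphB rmorph1; ring.
  have := cmod_tri ((d / r)%:C%C * (q i - p i)) (z - p i) 0.
  rewrite !subr0 -/d cmodM cmod_real gtr0_norm // (cmodC (q i)).
  have : d / r * cmod (p i - q i) < d.
    rewrite mulrAC ltr_pdivrMr // ltr_pM2l //; exact: pq.
  lra.
have h1 : cmod ((1 - d / r)%:C%C * (q i - p i)) < r.
  rewrite cmodM cmod_real ger0_norm ?subr_ge0 ?(ltW dr1) // (cmodC (q i)).
  apply: le_lt_trans (pq i); apply: ler_piMl; first exact: cmod_ge0.
  by rewrite lerBlDr lerDl ltW.
set u := _ * _ in h1 *.
have := sp _ _ ji; have := pq j.
have := cmod_tri (q j) (p j) (p i).
have := cmod_tri (z + u) (q j) (p i).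
have := cmodD u (z - p i).
rewrite addrCA addrA (cmodC (q j) (z + u)); rewrite -/d; lra.
Qed.

Lemma continuous_push (T : topologicalType) r (p q : 'I_m -> T -> C) (z : T -> C) :
  (forall i, continuous (p i)) -> (forall i, continuous (q i)) -> continuous z ->
  continuous (fun x => push r (p^~ x) (q^~ x) (z x)).
Proof.
move=> cp cq cz; apply: continuous_add; first exact: cz.
apply: continuous_sum => i; apply: continuous_mul; last first.
  by apply: continuous_sub; [exact: cq|exact: cp].
apply: continuous_real; apply: continuous_maxr; first exact: continuous_const.
apply: continuous_sub; first exact: continuous_const.
apply: continuous_mul; last exact: continuous_const.
by apply: continuous_cmod; apply: continuous_sub; [exact: cz|exact: cp].
Qed.

(** The factor 4 is the separation [push_avoid] asks for; r <= 1 keeps points at distance 1 from the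
    punctures outside every disc. *)
Lemma uniform_separated (v : 'I_m -> R -> C) :
  (forall i, continuous (v i)) ->
  (forall x, 0 <= x <= 1 -> injective (v^~ x)) ->
  exists2 r : R, 0 < r <= 1 & forall x, 0 <= x <= 1 ->
    forall i j, i != j -> 4 * r <= cmod (v i x - v j x).
Proof.
move=> cv iv.
suff [r r0 h] : exists2 r : R, 0 < r & forall x, 0 <= x <= 1 ->
    forall i j, i != j -> 4 * r <= cmod (v i x - v j x).
  exists (Num.min r 1); first by rewrite lt_min r0 ltr01 ge_min lexx orbT.
  move=> x hx i j ij; apply: le_trans (h x hx i j ij).
  by rewrite ler_pM2l // ge_min lexx.
apply: (@compact_uniform R _ _ _ (@compact_unit R)) => x hx.
have [d d0 hd] := inj_separated (iv x hx).
exists (d / 8); first by rewrite divr_gt0.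
near=> y => r r0 rd i j ij.
have vy : forall k, cmod (v k x - v k y) < d / 4.
  near: y; apply: (filter_forall (nbhs_filter x)) => k.
  by have /continuous_cmodP := cv k; apply; rewrite divr_gt0.
have := hd i j ij; have := vy i; have := vy j.
have := cmod_tri (v i y) (v i x) (v j x).
have := cmod_tri (v j y) (v i y) (v j x).
rewrite (cmodC (v j y) (v j x)); lra.
Unshelve. all: by end_near. Qed.

(** The constant choice N y x = w x avoids the punctures of time [x]; small pushes carry these back
    from time [x] to time [y]. On the diagonal they do not move, and [M] lies outside all discs, so
    both boundary values persist. *)
Lemma transport (v : 'I_m -> R -> C) (w : R -> C) (M : C) :
  (forall i, continuous (v i)) ->
  (forall x, 0 <= x <= 1 -> injective (v^~ x)) ->
  continuous w -> (forall x i, 0 <= x <= 1 -> w x != v i x) -> w 1 = M ->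
  (forall x i, 0 <= x <= 1 -> 1 <= cmod (M - v i x)) ->
  exists N : R -> R -> C,
  [/\ continuous (fun yx : R * R => N yx.1 yx.2),
      forall y x i, 0 <= y -> y <= x -> x <= 1 -> N y x != v i y,
      forall x, 0 <= x <= 1 -> N x x = w x &
      forall y, 0 <= y <= 1 -> N y 1 = M].
Proof.
move=> cv iv cw wv w1 Mv.
have [r /andP[r0 r1] sepr] := uniform_separated cv iv.
have [e e0 he] := continuous_uniform01 r0 cv.
pose e2 := e / 2; have e20 : 0 < e2 by rewrite divr_gt0.
(* For y <= x in the unit interval this time is [x] at c = 1 and [y] once c <= 0; lowering [c] by
   [e2] changes it by at most [e2]. *)
pose mid (c y x : R) := Num.max y (Num.min x c).
have cmid c : continuous (fun yx : R * R => mid c yx.1 yx.2).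
  apply: continuous_maxr; first by move=> z; exact: cvg_fst.
  apply: continuous_minr; last exact: continuous_const.
  by move=> z; exact: cvg_snd.
have mid01 c y x : 0 <= y -> y <= x -> x <= 1 -> 0 <= mid c y x <= 1.
  move=> y0 yx x1; rewrite /mid le_max y0 /= ge_max ge_min x1 andbT.
  exact: le_trans x1.
have max_lip (x y z d : R) : 0 <= d -> `|y - z| <= d ->
    `|Num.max x y - Num.max x z| <= d.
  rewrite !ler_norml => d0 yz.
  by case: (leP x y) => hy; case: (leP x z) => hz; lra.
have min_lip (x y z d : R) : 0 <= d -> `|y - z| <= d ->
    `|Num.min x y - Num.min x z| <= d.
  rewrite !ler_norml => d0 yz.
  by case: (leP x y) => hy; case: (leP x z) => hz; lra.
have main k : exists N : R -> R -> C,
  [/\ continuous (fun yx : R * R => N yx.1 yx.2),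
      forall y x i, 0 <= y -> y <= x -> x <= 1 ->
        N y x != v i (mid (1 - k%:R * e2) y x),
      forall x, 0 <= x <= 1 -> N x x = w x &
      forall y, 0 <= y <= 1 -> N y 1 = M].
  elim: k => [|k [N [cN vN Nx N1]]].
    exists (fun _ x => w x); split=> //.
    - by apply: (continuous_compose _ cw) => z; exact: cvg_snd.
    - move=> y x i y0 yx x1; rewrite mul0r subr0 /mid (min_idPl x1) (max_idPr yx).
      by rewrite wv // (le_trans y0).
  set c := 1 - k%:R * e2 in vN; set c' := 1 - k.+1%:R * e2.
  have cc' : c = c' + e2 by rewrite /c /c' -natr1; ring.
  exists (fun y x => push r (fun i => v i (mid c y x)) (fun i => v i (mid c' y x)) (N y x)).
  split.
  - apply: continuous_push; last exact: cN.
      by move=> i; exact: continuous_compose (cmid c) (cv i).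
    by move=> i; exact: continuous_compose (cmid c') (cv i).
  - move=> y x i y0 yx x1.
    have h1 := mid01 c _ _ y0 yx x1; have h2 := mid01 c' _ _ y0 yx x1.
    apply: push_avoid => //; last by move=> k'; exact: vN.
      by apply: sepr.
    move=> k'; apply: he => //.
    apply: (@le_lt_trans _ _ e2); last by rewrite /e2; lra.
    apply/max_lip/min_lip; rewrite ?(ltW e20) //.
    by rewrite cc' addrC addKr gtr0_norm.
  - move=> x hx; rewrite -[RHS]Nx //.
    have E c0 : mid c0 x x = x by rewrite /mid; apply/max_idPl; rewrite ge_min lexx.
    by rewrite !E push_id.
  - move=> y hy; rewrite N1 // push_far // => i.
    apply: (le_trans r1); apply: Mv; apply: mid01 => //; by case/andP: hy.
have [k hk] : exists k : nat, 1 <= k%:R * e2.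
  exists (Num.truncn e2^-1).+1.
  by rewrite -ler_pdivrMr // mul1r ltW // truncnS_gt.
have [N [cN vN Nx N1]] := main k; exists N; split=> // y x i y0 yx x1.
have := vN y x i y0 yx x1; rewrite (_ : mid _ y x = y) //.
apply/max_idPl; rewrite ge_min; apply/orP; right; lra.
Qed.

End Transport.

(** Recursion on the syntactic form of the function, with constants as the fallback; the clauses
    without [fun] match eta-reduced operations. *)
Ltac solve_continuous := repeat first
  [ assumption
  | lazymatch goal with |- forall x, @continuous_at _ _ x ?f =>
    lazymatch f with
    | (fun y => y) => exact: continuous_ident
    | (fun y => @fst _ _ y) => by move=> ?; exact: cvg_fst
    | (fun y => @snd _ _ y) => by move=> ?; exact: cvg_snd
    | @fst _ _ => by move=> ?; exact: cvg_fst
    | @snd _ _ => by move=> ?; exact: cvg_snd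
    | (fun y => @clamp _ _) => apply: continuous_clamp
    | (fun y => @GRing.add _ _ (@GRing.opp _ _)) => apply: continuous_sub
    | (fun y => @GRing.add _ _ _) => apply: continuous_add
    | (fun y => @GRing.mul _ _ _) => apply: continuous_mul
    | @GRing.mul _ _ => apply: continuous_mul
    | @GRing.add _ _ => apply: continuous_add
    | @GRing.opp _ => apply: continuous_opp
    | _ => exact: continuous_const
    end end ].

(** * Homotopies of paths of polynomials *)

Section Homotopy.
Variables (R : realType) (n : nat).
Notation C := (CC R).
Implicit Types Q : R -> {poly C}.

Lemma continuous_within_clamp (f : R -> C) :
  {within `[0, 1], continuous f} -> continuous (fun t => f (clamp t)).
Proof.
move=> /subspace_continuousP h; apply/continuous_cmodP => x e e0.
have x01 : `[0, 1]%classic (clamp x) by rewrite /= in_itv clamp01.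
have /cvg_cmodP/(_ e e0) H := h _ x01.
have cc : continuous (@clamp R) by apply: continuous_clamp; exact: continuous_ident.
have K : nbhs x _ := cc x _ H.
by apply: (filterS _ K) => y /=; apply; rewrite in_itv clamp01.
Qed.

Lemma bounded01 (I : finType) (f : I -> R -> C) : (forall i, continuous (f i)) ->
  exists2 B : R, 0 <= B & forall i t, 0 <= t <= 1 -> cmod (f i t) <= B.
Proof.
move=> cf.
(* The bound is sought as an inverse because [compact_uniform] produces small numbers. *)
have [d d0 hd] : exists2 d : R, 0 < d &
    forall t, [set t : R | 0 <= t <= 1] t -> forall i, cmod (f i t) <= d^-1.
  apply: compact_uniform; first exact: compact_unit.
  move=> x _; pose L := 1 + \sum_i cmod (f i x).
  have s0 : 0 <= \sum_i cmod (f i x) by apply: sumr_ge0 => i _; exact: cmod_ge0.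
  have L0 : 0 < L by rewrite ltr_wpDr.
  exists L^-1; first by rewrite invr_gt0.
  near=> y => d d0 dL i.
  have xy : forall i, cmod (f i x - f i y) < 1.
    near: y; apply: (filter_forall (nbhs_filter x)) => j.
    by have /continuous_cmodP := cf j; apply.
  have Ld : L <= d^-1 by rewrite ltW // -[L]invrK ltf_pV2 ?posrE ?invr_gt0.
  apply: le_trans Ld; have := cmod_tri (f i x) (f i y) 0; rewrite !subr0.
  have : cmod (f i x) <= \sum_i cmod (f i x).
    by rewrite (bigD1 i) //= lerDl sumr_ge0 // => j _; exact: cmod_ge0.
  have := xy i; rewrite cmodC /L; lra.
exists d^-1; first by rewrite invr_ge0 ltW.
by move=> i t ht; exact: hd.
Unshelve. all: by end_near. Qed.

(** Homotopy relative to endpoints in the complement of the discriminant; [G] is continuous on the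
    whole plane but has simple roots only over the unit square. *)
Definition homotopic Q0 Q1 := exists G : R * R -> {poly C},
  [/\ cpoly G,
      forall s t, 0 <= s <= 1 -> 0 <= t <= 1 -> split_simple n (G (s, t)),
      forall t, 0 <= t <= 1 -> G (0, t) = Q0 t,
      forall t, 0 <= t <= 1 -> G (1, t) = Q1 t &
      forall s, 0 <= s <= 1 -> G (s, 0) = Q0 0 /\ G (s, 1) = Q0 1].

Lemma homotopic_trans Q0 Q1 Q2 :
  homotopic Q0 Q1 -> homotopic Q1 Q2 -> homotopic Q0 Q2.
Proof.
have h01 : 0 <= (0 : R) <= 1 by rewrite lexx ler01.
have h11 : 0 <= (1 : R) <= 1 by rewrite lexx ler01.
move=> [G1 [c1 s1 l1 r1 e1]] [G2 [c2 s2 l2 r2 e2]].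
(* In the first half the [G2] terms cancel; in the second half the first term is stuck at
   [G1 (1, t)], which equals [G2 (0, t)] and cancels. *)
pose G (x : R * R) :=
  G1 (clamp (2 * x.1), x.2) + G2 (clamp (2 * x.1 - 1), x.2) - G2 (0, x.2).
have first_half s t : 0 <= t <= 1 -> s <= 1 / 2 -> G (s, t) = G1 (clamp (2 * s), t).
  move=> ht hs; rewrite /G /= (_ : clamp (2 * s - 1) = 0) ?addrK //.
  by apply/max_idPl; rewrite ge_min; apply/orP; right; lra.
have second_half s t : 0 <= t <= 1 -> 1 / 2 <= s ->
    G (s, t) = G2 (clamp (2 * s - 1), t).
  move=> ht hs; rewrite /G /= (_ : clamp (2 * s) = 1).
    by rewrite r1 // l2 // addrAC subrr add0r.
  by rewrite /clamp (min_idPl _) ?(max_idPr ler01) //; lra.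
have half (s : R) : s <= 1 / 2 \/ 1 / 2 <= s.
  by apply/orP; exact: le_total.
exists G; split.
- apply: cpolyB; first (apply: cpolyD).
  + by apply: (cpoly_compose _ c1); apply: continuous_pair; solve_continuous.
  + by apply: (cpoly_compose _ c2); apply: continuous_pair; solve_continuous.
  + by apply: (cpoly_compose _ c2); apply: continuous_pair; solve_continuous.
- move=> s t hs ht; case: (half s) => hh.
    by rewrite first_half //; apply: s1 => //; exact: clamp01.
  by rewrite second_half //; apply: s2 => //; exact: clamp01.
- by move=> t ht; rewrite first_half ?mulr0 ?clamp0 ?l1 //; lra.
- move=> t ht; rewrite second_half //; last by lra.
  by rewrite (_ : 2 * 1 - 1 = 1 :> R) ?clamp1 ?r2 //; ring.
- have [a1 b1] := e1 1 h11; rewrite !r1 // in a1 b1.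
  move=> s hs; case: (half s) => hh.
    by rewrite !first_half //; apply: e1; exact: clamp01.
  by rewrite !second_half // -a1 -b1; apply: e2; exact: clamp01.
Qed.

End Homotopy.

(** * Bounds on critical values, and shifts by constants *)

Section CriticalBound.
Variables (R : realType) (m : nat).
Notation C := (CC R).

(** The coefficients of p'/(m+1) are those of [p] times factors at most 1, so [root_bound] confines
    the critical points, and hence the values there. *)
Lemma critical_bound (B : R) : 0 <= B -> exists2 M : R, 0 <= M &
  forall p : {poly C}, p \is monic -> size p = m.+2 ->
  (forall i, cmod p`_i <= B) ->
  forall z, root p^`() z -> cmod p.[z] <= M.
Proof.
move=> B0; pose L := 1 + m%:R * B.
have L0 : 0 <= L by rewrite addr_ge0 // mulr_ge0.
exists (\sum_(i < m.+2) B * L ^+ i).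
  by apply: sumr_ge0 => i _; rewrite mulr_ge0 // exprn_ge0.
move=> p pm sp hB z rz.
have n0 : (m.+1%:R : C) != 0 by rewrite pnatr_eq0.
have zL : cmod z <= L.
  apply: (@root_bound _ m (m.+1%:R^-1 *: p^`())).
  - rewrite monicE lead_coefZ lead_coefE (size_deriv_monic pm sp) coef_deriv.
    by have := monicP pm; rewrite lead_coefE sp => ->; rewrite mulVf.
  - by rewrite size_scale ?invr_eq0 // (size_deriv_monic pm sp).
  - move=> i; have [im|im] := leqP m.+1 i.
      rewrite nth_default ?cmod0 //.
      by rewrite size_scale ?invr_eq0 // (size_deriv_monic pm sp).
    rewrite coefZ coef_deriv -[p`_i.+1 *+ _]mulr_natr mulrCA cmodM.
    apply: le_trans (hB i.+1); apply: ler_piMr; first exact: cmod_ge0.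
    rewrite -[X in cmod (X^-1 * _)](rmorph_nat (@real_complex R)).
    rewrite -[X in cmod (_ * X)](rmorph_nat (@real_complex R)).
    rewrite -fmorphV -rmorphM cmod_real ger0_norm ?mulr_ge0 ?invr_ge0 //.
    by rewrite mulrC ler_pdivrMr ?ltr0n // mul1r ler_nat.
  - by rewrite rootZ ?invr_eq0.
rewrite horner_coef sp (le_trans (cmod_sum _ _ _)) //; apply: ler_sum => i _.
rewrite cmodM cmodX; apply: ler_pM; rewrite ?exprn_ge0 ?cmod_ge0 //.
by apply: lerXn2r; rewrite ?nnegrE ?cmod_ge0.
Qed.

Lemma monic_shift (Q : {poly C}) c : Q \is monic -> size Q = m.+2 ->
  Q - c%:P \is monic /\ size (Q - c%:P) = m.+2.
Proof.
move=> Qm sQ; have sc : (size (- c%:P) < size Q)%N.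
  by rewrite size_polyN sQ (leq_ltn_trans (size_polyC_leq1 _)).
by rewrite monicE lead_coefDl // size_polyDl.
Qed.

Lemma split_simple_shift (Q : {poly C}) c : Q \is monic -> size Q = m.+2 ->
  (forall z, root Q^`() z -> Q.[z] != c) -> split_simple m.+1 (Q - c%:P).
Proof.
move=> Qm sQ h; have [sm ss] := monic_shift c Qm sQ.
apply: split_simpleI => // z.
rewrite derivB derivC subr0 /root hornerD hornerN hornerC subr_eq0 => rz.
by apply/negP => /h; rewrite rz.
Qed.

Lemma split_simple_shift_crit (Q : {poly C}) c z :
  split_simple m.+1 (Q - c%:P) -> root Q^`() z -> Q.[z] != c.
Proof.
move=> sQ rz; apply/negP => Qz; have := @split_simple_deriv _ _ _ z sQ.
by rewrite derivB derivC subr0 rz /root hornerD hornerN hornerC subr_eq0 Qz => /(_ isT).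
Qed.

End CriticalBound.

(** * Deforming a loop of polynomials into one line *)

Section Monodromy.
Variables (R : realType) (m : nat).
Notation C := (CC R).

(** Clocks of the three thirds of the unit interval: outward path, loop at height [M], way back. *)
Let tau1 (t : R) := clamp (3 * t).
Let tau2 (t : R) := clamp (3 * t - 1).
Let tau3 (t : R) := clamp (3 * t - 2).

Lemma three_phases t : [\/ tau2 t = 0 /\ tau3 t = 0, tau1 t = 1 /\ tau3 t = 0 |
  tau1 t = 1 /\ tau2 t = 1].
Proof.
rewrite /tau1 /tau2 /tau3.
case/orP: (le_total (3 * t) 1) => h1.
  by constructor 1; rewrite !clamp_low //; lra.
case/orP: (le_total (3 * t) 2) => h2.
  by constructor 2; rewrite clamp_high // clamp_low //; lra.
by constructor 3; rewrite !clamp_high //; lra.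
Qed.

Lemma convex_combination_close (r s : R) (x y z w : C) : 0 <= s <= 1 ->
  4 * r <= cmod (x - y) -> cmod (z - x) < r -> cmod (w - y) < r ->
  (1 - s)%:C%C * x + s%:C%C * z != (1 - s)%:C%C * y + s%:C%C * w.
Proof.
move=> /andP[s0 s1] h hz hw; apply/negP => /eqP E.
have : cmod (x - y) <= cmod (w - y) + cmod (z - x).
  have -> : x - y = s%:C%C * ((w - y) - (z - x)).
    move/eqP: E; rewrite -subr_eq0 => /eqP E; apply/eqP; rewrite -subr_eq0 -[X in _ == X]E.
    by apply/eqP; rewrite rmorphB rmorph1; ring.
  rewrite cmodM cmod_real ger0_norm // (le_trans _ (cmodB _ _)) //.
  by apply: ler_piMl => //; exact: cmod_ge0.
have := cmod_ge0 (w - y); lra.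
Qed.

(** The product [prodX] forgets the labels of the strands, so a braid that permutes the base points
    still gives a closed loop here. *)
Lemma homotopic_fibre_loop (b : 'I_m.+1 -> R -> C) :
  (forall j, continuous (b j)) ->
  (forall t, 0 <= t <= 1 -> injective (b^~ t)) ->
  prodX (b^~ 1) = prodX (b^~ 0) -> generic m (prodX (b^~ 0)) ->
  exists c : R -> C, [/\ continuous c, c 0 = 0, c 1 = 0 &
    homotopic m.+1 (fun t => prodX (b^~ t)) (fun t => prodX (b^~ 0) - (c t)%:P)].
Proof.
move=> cb ib b10 g0.
have h01 : 0 <= (0 : R) <= 1 by rewrite lexx ler01.
have h11 : 0 <= (1 : R) <= 1 by rewrite lexx ler01.
have [r /andP[r0 _] sepb] := uniform_separated cb ib.
have g1 : generic m (prodX (b^~ 1)) by rewrite b10.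
have [a [ca ga ab a0 a1]] := perturb_generic r0 cb g0 g1.
have convex_inj s t : 0 <= s <= 1 -> 0 <= t <= 1 ->
    injective (fun j => (1 - s)%:C%C * b j t + s%:C%C * a j t).
  move=> hs ht i j E; apply/eqP/negPn/negP => ij.
  have := @convex_combination_close r s _ _ (a i t) (a j t) hs (sepb t ht i j ij)
    (ab i t ht) (ab j t ht).
  by rewrite E eqxx.
have ia t : 0 <= t <= 1 -> injective (a^~ t).
  move=> ht i j E; apply: (convex_inj 1 t h11 ht).
  by rewrite subrr !mul0r E.
(* The loop is run in the first half and rests in the second, where [w] travels from 0 to [M] among
   punctures at rest. *)
pose Q x := prodX (fun j => a j (clamp (2 * x))).
have Q0E : Q 0 = prodX (b^~ 0).
  by congr prodX; apply/funext => j; rewrite mulr0 clamp0 a0.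
have Qhigh x : 1 / 2 <= x -> Q x = prodX (b^~ 0).
  move=> hx; rewrite -b10; congr prodX; apply/funext => j.
  by rewrite clamp_high ?a1 //; lra.
have Q1E : Q 1 = prodX (b^~ 0) by apply: Qhigh; lra.
have Qm x : Q x \is monic by exact: prodX_monic.
have sQ x : size (Q x) = m.+2 by exact: size_prodX.
have cQ : cpoly Q.
  apply: cpoly_prod_XsubC => j; apply: (continuous_compose _ (ca j)).
  by solve_continuous.
have gQ x : generic m (Q x) by apply: ga; exact: clamp01.
have simpleQ x : split_simple m.+1 (Q x).
  by exists (fun j => a j (clamp (2 * x))) => //; apply: ia; exact: clamp01.
have [v [cv iv crit_v v_crit]] := critical_values_lift cQ
  (fun t _ => And3 (Qm t) (sQ t) (gQ t)).
have simple_v x c : 0 <= x <= 1 -> (forall i, c != v i x) ->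
    split_simple m.+1 (Q x - c%:P).
  move=> hx h; apply: split_simple_shift => // z rz.
  by have [i ->] := crit_v x z hx rz; rewrite eq_sym.
have v0 x i : 0 <= x <= 1 -> 0 != v i x.
  move=> hx; have [z rz <-] := v_crit x i hx; rewrite eq_sym.
  by apply: (split_simple_shift_crit (Q := Q x)) => //; rewrite subr0.
have [B B0 hB] : exists2 B : R, 0 <= B &
    forall (i : 'I_m.+2) t, 0 <= t <= 1 -> cmod (Q t)`_i <= B.
  by apply: bounded01 => i; exact: cQ.
have hB' i t : 0 <= t <= 1 -> cmod (Q t)`_i <= B.
  move=> ht; have [im|im] := ltnP i m.+2; first exact: (hB (Ordinal im)).
  by rewrite nth_default ?cmod0 // sQ.
have [M0 M00 hM0] := critical_bound m B0.
(* The summand 1 provides the distance to the punctures that [transport] requires. *)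
pose M : C := (M0 + 1)%:C%C.
have cM : cmod M = M0 + 1 by rewrite cmod_real ger0_norm // addr_ge0.
have Mn0 : M != 0 by rewrite -cmod_gt0 cM; lra.
have Mv x i : 0 <= x <= 1 -> 1 <= cmod (M - v i x).
  move=> hx; have [z rz <-] := v_crit x i hx.
  have := hM0 (Q x) (Qm x) (sQ x) (fun i => hB' i x hx) z rz.
  have := cmod_tri (Q x).[z] M 0; rewrite !subr0 cM; lra.
have Mv' x i : 0 <= x <= 1 -> M != v i x.
  by move=> hx; rewrite -subr_eq0 -cmod_gt0; have := Mv x i hx; lra.
(* Division by [M] rescales the segment from 0 to [M] to the one from 0 to 1; [mu] scales back. *)
have [||u [cu u0 u1 hu]] := @avoiding_path R [seq v i 1 / M | i <- enum 'I_m].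
- apply/mapP => -[i _ /esym/eqP]; rewrite mulf_eq0 invr_eq0 (negbTE Mn0) orbF.
  by rewrite eq_sym (negbTE (v0 1 i h11)).
- apply/mapP => -[i _ E]; have := Mv' 1 i h11.
  by rewrite -[v i 1](divfK Mn0) -E mul1r eqxx.
pose mu x := u x * M.
have cmu : continuous mu by apply: continuous_mul cu _; exact: continuous_const.
have mu0 : mu 0 = 0 by rewrite /mu u0 mul0r.
have mu1 : mu 1 = M by rewrite /mu u1 mul1r.
have mu_v x i : 0 <= x <= 1 -> mu x != v i 1.
  move=> /hu[h _]; apply: contra h => /eqP E; apply/mapP; exists i.
    by rewrite mem_enum.
  by rewrite -E /mu mulfK.
have simple_mu x y : 1 / 2 <= x -> 0 <= y <= 1 ->
    split_simple m.+1 (Q x - (mu y)%:P).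
  by move=> hx hy; rewrite Qhigh // -Q1E; apply: simple_v => // i; exact: mu_v.
pose w x := mu (clamp (2 * x - 1)).
have cw : continuous w by apply: (continuous_compose _ cmu); solve_continuous.
have simple_w s x : 0 <= s <= 1 -> split_simple m.+1 (Q x - (mu (s * clamp (2 * x - 1)))%:P).
  move=> /andP[s0 s1]; case/orP: (le_total x (1 / 2)) => hx.
    by rewrite clamp_low ?mulr0 ?mu0 ?polyC0 ?subr0 //; lra.
  apply: simple_mu => //; rewrite mulr_ge0 ?clamp_ge0 //=.
  by apply: mulr_ile1; rewrite ?clamp_ge0 ?clamp_le1.
have wv x i : 0 <= x <= 1 -> w x != v i x.
  move=> hx; have [z rz <-] := v_crit x i hx; rewrite eq_sym.
  apply: split_simple_shift_crit rz.
  rewrite -[w x]/(mu _) -[clamp _]mul1r; exact: simple_w.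
have w1 : w 1 = M by rewrite /w clamp_high ?mu1 //; lra.
have [N [cN vN Nx N1]] := transport cv iv cw wv w1 Mv.
have t01 t : 0 <= tau1 t <= 1 by exact: clamp01.
have t02 t : 0 <= tau2 t <= 1 by exact: clamp01.
have t03 t : 0 <= 1 - tau3 t <= 1.
  by have := clamp_ge0 (3 * t - 2); have := clamp_le1 (3 * t - 2); rewrite /tau3; lra.
have tau_0 : [/\ tau1 0 = 0, tau2 0 = 0 & tau3 0 = 0].
  by rewrite /tau1 /tau2 /tau3 !clamp_low //; lra.
have tau_1 : [/\ tau1 1 = 1, tau2 1 = 1 & tau3 1 = 1].
  by rewrite /tau1 /tau2 /tau3 !clamp_high //; lra.
have ct1 : continuous tau1 by rewrite /tau1; solve_continuous.
have ct2 : continuous tau2 by rewrite /tau2; solve_continuous.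
have ct3 : continuous tau3 by rewrite /tau3; solve_continuous.
have w_0 : w 0 = 0 by rewrite /w clamp_low ?mu0 //; lra.
have homotopy1 : homotopic m.+1 (fun t => prodX (b^~ t)) (fun t => Q (tau1 t)).
  pose sg (x : R * R) := (1 - x.1) * x.2 + x.1 * clamp (2 * tau1 x.2).
  have csg : continuous sg.
    have ct : continuous (fun x : R * R => tau1 x.2).
      by apply: (continuous_compose _ ct1); solve_continuous.
    by rewrite /sg; solve_continuous.
  have sg01 s t : 0 <= s <= 1 -> 0 <= t <= 1 -> 0 <= sg (s, t) <= 1.
    move=> /andP[s0 s1] /andP[t0 t1]; rewrite /sg /=.
    have := clamp_ge0 (2 * tau1 t); have := clamp_le1 (2 * tau1 t); nra.
  exists (fun x => prodX (fun j =>
    (1 - x.1)%:C%C * b j (sg x) + x.1%:C%C * a j (sg x))); split.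
  - apply: cpoly_prod_XsubC => j; apply: continuous_add.
      apply: continuous_mul; first by apply: continuous_real; solve_continuous.
      exact: (continuous_compose csg (cb j)).
    apply: continuous_mul; first by apply: continuous_real; solve_continuous.
    exact: (continuous_compose csg (ca j)).
  - move=> s t hs ht; eexists; first by [].
    by apply: convex_inj => //; exact: sg01.
  - move=> t _; congr prodX; apply/funext => j /=.
    by rewrite /sg /= subr0 !mul0r !mul1r !addr0.
  - move=> t _; congr prodX; apply/funext => j /=.
    by rewrite /sg /= subrr !mul0r !mul1r !add0r.
  - have E (s : R) x y : x = y -> (1 - s)%:C%C * y + s%:C%C * x = y :> C.
      by move=> ->; rewrite rmorphB rmorph1; ring.
    move=> s _; case: tau_0 => z1 _ _; case: tau_1 => z2 _ _; split;
      congr prodX; apply/funext => j /=; rewrite /sg /=.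
      by rewrite z1 !mulr0 clamp0 mulr0 addr0 E.
    have -> : (1 - s) * 1 + s * clamp (2 * tau1 1) = 1.
      by rewrite z2 clamp_high; [ring|lra].
    by rewrite E.
(* The excursion grows with s: its turning point is [mu s]. In each third all but one of the [mu]
   terms cancel, leaving the outward or the return path. *)
have homotopy2 : homotopic m.+1 (fun t => Q (tau1 t))
    (fun t => Q (tau1 t) - (w (tau1 t) + mu (1 - tau3 t) - M)%:P).
  exists (fun x => Q (tau1 x.2) - (mu (x.1 * clamp (2 * tau1 x.2 - 1)) +
    mu (x.1 * (1 - tau3 x.2)) - mu x.1)%:P); split.
  - have ct1' : continuous (fun x : R * R => tau1 x.2).
      by apply: (continuous_compose _ ct1); solve_continuous.
    have ct3' : continuous (fun x : R * R => tau3 x.2).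
      by apply: (continuous_compose _ ct3); solve_continuous.
    apply: cpolyB; first exact: (cpoly_compose ct1' cQ).
    apply: cpolyC; apply: continuous_sub; first apply: continuous_add.
    + by apply: (continuous_compose _ cmu); solve_continuous.
    + by apply: (continuous_compose _ cmu); solve_continuous.
    + by apply: (continuous_compose _ cmu); solve_continuous.
  - move=> s t hs ht /=.
    have [[_ ->]|[_ ->]|[-> _]] := three_phases t.
    + by rewrite subr0 mulr1 addrK; exact: simple_w.
    + by rewrite subr0 mulr1 addrK; exact: simple_w.
    + rewrite [clamp _]clamp_high ?mulr1; last by lra.
      rewrite addrAC subrr add0r; apply: simple_mu; first by lra.
      case/andP: hs => s0 s1; case/andP: (t03 t) => z0 z1.
      by rewrite mulr_ge0 //= mulr_ile1.
  - by move=> t _ /=; rewrite !mul0r mu0 addr0 subrr subr0.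
  - by move=> t _ /=; rewrite !mul1r mu1.
  - move=> s _ /=; case: tau_0 => -> _ ->; case: tau_1 => -> _ ->; split.
      rewrite clamp_low; last by lra.
      by rewrite subr0 mulr0 mulr1 mu0 add0r subrr subr0.
    rewrite clamp_high; last by lra.
    by rewrite subrr mulr0 mulr1 mu0 addr0 subrr subr0.
(* The run of the loop is delayed from the first third to the second. Meanwhile [N] adapts the
   outward path to the punctures of the delayed time, and in the second third the shift is [M]. *)
have homotopy3 : homotopic m.+1
    (fun t => Q (tau1 t) - (w (tau1 t) + mu (1 - tau3 t) - M)%:P)
    (fun t => Q (tau2 t) - (N 0 (tau1 t) + mu (1 - tau3 t) - M)%:P).
  exists (fun x => Q ((1 - x.1) * tau1 x.2 + x.1 * tau2 x.2) -
    (N ((1 - x.1) * tau1 x.2) (tau1 x.2) + mu (1 - tau3 x.2) - M)%:P); split.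
  - have ct1' : continuous (fun x : R * R => tau1 x.2).
      by apply: (continuous_compose _ ct1); solve_continuous.
    have ct2' : continuous (fun x : R * R => tau2 x.2).
      by apply: (continuous_compose _ ct2); solve_continuous.
    have ct3' : continuous (fun x : R * R => tau3 x.2).
      by apply: (continuous_compose _ ct3); solve_continuous.
    apply: cpolyB; first by apply: (cpoly_compose _ cQ); solve_continuous.
    apply: cpolyC; apply: continuous_sub; last exact: continuous_const.
    apply: continuous_add.
      apply: (continuous_compose (f := fun x : R * R =>
        ((1 - x.1) * tau1 x.2, tau1 x.2)) _ cN).
      by apply: continuous_pair; solve_continuous.
    by apply: (continuous_compose _ cmu); solve_continuous.
  - move=> s t /andP[s0 s1] ht /=; have [[-> ->]|[-> ->]|[-> ->]] := three_phases t.
    + rewrite subr0 mu1 addrK mulr0 addr0.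
      case/andP: (t01 t) => z0 z1.
      have y0 : 0 <= (1 - s) * tau1 t by rewrite mulr_ge0 // subr_ge0.
      have y1 : (1 - s) * tau1 t <= tau1 t.
        by apply: ler_piMl => //; rewrite lerBlDr lerDl.
      apply: simple_v; first by rewrite y0 (le_trans y1).
      by move=> i; exact: vN.
    + rewrite subr0 mu1 addrK mulr1 N1; last by rewrite subr_ge0 s1 lerBlDr lerDl.
      case/andP: (t02 t) => z0 z1.
      have y01 : 0 <= 1 - s + s * tau2 t <= 1 by nra.
      by apply: simple_v => // i; exact: Mv'.
    + rewrite !mulr1 subrK N1; last by rewrite subr_ge0 s1 lerBlDr lerDl.
      by rewrite addrAC subrr add0r; apply: simple_mu => //; lra.
  - by move=> t _ /=; rewrite subr0 mul1r mul0r addr0 Nx.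
  - by move=> t _ /=; rewrite subrr !mul0r mul1r add0r.
  - move=> s hs /=; case: tau_0 => -> -> ->; case: tau_1 => -> -> ->; split.
      by rewrite !mulr0 addr0 Nx.
    rewrite !mulr1 subrK N1 ?w1 //.
    by case/andP: hs => s0 s1; rewrite subr_ge0 s1 lerBlDr lerDl.
have comb s p : (1 - s)%:C%C *: p + s%:C%C *: p = p :> {poly C}.
  by rewrite -scalerDl rmorphB rmorph1 subrK scale1r.
have convex_bound s t : 0 <= s <= 1 -> 0 <= t <= 1 ->
    let K := (1 - s)%:C%C *: Q t + s%:C%C *: Q 0 in
    [/\ K \is monic, size K = m.+2 & forall i, cmod K`_i <= B].
  move=> /andP[s0 s1] ht K.
  have s1' : 0 <= 1 - s by rewrite subr_ge0.
  have lead x : (Q x)`_m.+1 = 1 by have := monicP (Qm x); rewrite lead_coefE sQ.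
  have K1 : K`_m.+1 = 1.
    by rewrite coefD !coefZ !lead !mulr1 rmorphB rmorph1 subrK.
  have sK : size K = m.+2.
    apply/eqP; rewrite eqn_leq; apply/andP; split.
      apply: (leq_trans (size_polyD _ _)); rewrite geq_max.
      by rewrite !(leq_trans (size_scale_leq _ _)) ?sQ.
    rewrite ltnNge; apply/negP => /leq_sizeP/(_ m.+1 (leqnn _)).
    by rewrite K1 => /eqP; rewrite oner_eq0.
  split=> //; first by rewrite monicE lead_coefE sK K1.
  move=> i; rewrite coefD !coefZ (le_trans (cmodD _ _)) // !cmodM !cmod_real.
  rewrite !ger0_norm //; have := hB' i t ht; have := hB' i 0 h01; nra.
(* The convex combination acts only in the middle third, where the shift is [M]; in the other two
   [Q (tau2 t)] already equals [Q 0]. *)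
have homotopy4 : homotopic m.+1
    (fun t => Q (tau2 t) - (N 0 (tau1 t) + mu (1 - tau3 t) - M)%:P)
    (fun t => prodX (b^~ 0) - (N 0 (tau1 t) + mu (1 - tau3 t) - M)%:P).
  exists (fun x => (1 - x.1)%:C%C *: Q (tau2 x.2) + x.1%:C%C *: Q 0 -
    (N 0 (tau1 x.2) + mu (1 - tau3 x.2) - M)%:P); split.
  - have ct1' : continuous (fun x : R * R => tau1 x.2).
      by apply: (continuous_compose _ ct1); solve_continuous.
    have ct2' : continuous (fun x : R * R => tau2 x.2).
      by apply: (continuous_compose _ ct2); solve_continuous.
    have ct3' : continuous (fun x : R * R => tau3 x.2).
      by apply: (continuous_compose _ ct3); solve_continuous.
    apply: cpolyB; first apply: cpolyD.
    + apply: cpolyZ; first by apply: continuous_real; solve_continuous.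
      exact: (cpoly_compose ct2' cQ).
    + apply: cpolyZ; first by apply: continuous_real; solve_continuous.
      exact: cpoly_const.
    + apply: cpolyC; apply: continuous_sub; last exact: continuous_const.
      apply: continuous_add.
        apply: (continuous_compose (f := fun x : R * R => (0, tau1 x.2)) _ cN).
        by apply: continuous_pair; solve_continuous.
      by apply: (continuous_compose _ cmu); solve_continuous.
  - move=> s t hs ht /=; have [[-> ->]|[-> ->]|[-> ->]] := three_phases t.
    + rewrite comb subr0 mu1 addrK; case/andP: (t01 t) => z0 z1.
      by apply: simple_v => // i; exact: vN.
    + rewrite subr0 mu1 addrK N1 //.
      have [Km Ks KB] := convex_bound s (tau2 t) hs (t02 t).
      apply: split_simple_shift => // z rz.
      have h := hM0 _ Km Ks KB z rz.
      by apply/negP => /eqP E; move: h; rewrite E cM; lra.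
    + rewrite Q1E -Q0E comb N1 // addrAC subrr add0r Q0E -Q1E.
      by apply: simple_mu => //; lra.
  - by move=> t _ /=; rewrite subr0 rmorph1 rmorph0 scale1r scale0r addr0.
  - by move=> t _ /=; rewrite subrr rmorph1 rmorph0 scale1r scale0r add0r Q0E.
  - move=> s hs /=; case: tau_0 => -> -> ->; case: tau_1 => -> -> ->.
    by rewrite Q1E -Q0E !comb.
exists (fun t => N 0 (tau1 t) + mu (1 - tau3 t) - M); split.
- apply: continuous_sub; last exact: continuous_const.
  apply: continuous_add.
    apply: (continuous_compose (f := fun t => (0, tau1 t)) _ cN).
    by apply: continuous_pair; solve_continuous.
  by apply: (continuous_compose _ cmu); solve_continuous.
- case: tau_0 => -> _ ->; rewrite Nx // w_0 subr0 mu1; ring.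
- by case: tau_1 => -> _ ->; rewrite N1 // subrr mu0 addr0 subrr.
apply: homotopic_trans homotopy1 _; apply: homotopic_trans homotopy2 _.
exact: homotopic_trans homotopy3 homotopy4.
Qed.

End Monodromy.

(** * From the homotopy of polynomials back to braids *)

Theorem theorem1 (R : realType) (n : nat) (P : {poly CC R}) :
  (1 < n)%N ->
  P \is monic -> size P = n.+1 ->
  (exists s : seq (CC R),
      [/\ uniq s, size s = n.-1 & crit_values P = [set` s]]) ->
  forall w0 : CC R, ~ crit_values P w0 ->
  monodromy_surjective n P w0.
Proof.
case: n => [//|m] _ Pm sP [sv [usv ssv svE]] w0 _ b [cb ib b0 b1].
have itv (t : R) : (t \in `[0, 1]) = (0 <= t <= 1) by rewrite mem_setE in_itv.
have h01 : 0 <= (0 : R) <= 1 by rewrite lexx ler01.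
have h11 : 0 <= (1 : R) <= 1 by rewrite lexx ler01.
pose bc j t := b j (clamp t).
have bcE j t : 0 <= t <= 1 -> bc j t = b j t by move=> ht; rewrite /bc clampE.
have cbc j : continuous (bc j) by exact: continuous_within_clamp.
have ibc t : 0 <= t <= 1 -> injective (bc^~ t).
  by move=> ht; apply: (ib (clamp t)); rewrite itv clamp01.
have [sm ss] := monic_shift w0 Pm sP.
have endpoint t : 0 <= t <= 1 -> [set b j t | j in setT] = fibre P w0 ->
    prodX (bc^~ t) = P - w0%:P.
  move=> ht bt; apply/esym/prodX_eq => //; first exact: ibc.
  move=> j; rewrite bcE // /root hornerD hornerN hornerC subr_eq0.
  have : fibre P w0 (b j t) by rewrite -bt; exists j.
  by move=> /= ->.
have E0 := endpoint 0 h01 b0; have E1 := endpoint 1 h11 b1.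
have gP : generic m (prodX (bc^~ 0)).
  have hx (i : 'I_m) : exists z : CC R, root P^`() z /\ P.[z] = nth 0 sv i.
    have : crit_values P (nth 0 sv i).
      by rewrite svE /= mem_nth // ssv.
    by case=> z rz Pz; exists z.
  have [xi hxi] := choice hx.
  exists xi => [i|i j]; rewrite E0.
    by rewrite derivB derivC subr0; have [] := hxi i.
  rewrite !hornerE => /addIr.
  have [_ ->] := hxi i; have [_ ->] := hxi j => /eqP.
  by rewrite nth_uniq ?ssv // => /eqP/val_inj.
have [c [cc c0 c1 [G [cG sG G0 G1 Gb]]]] :=
  homotopic_fibre_loop cbc ibc (etrans E1 (esym E0)) gP.
have [j t ht|H [cH rH iH H0 Hc]] := lift_homotopy cG sG cbc _ ibc.
  by rewrite G0 // prodX_root.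
(* The homotopy of polynomials is constant at both ends, so the lifted strands keep their
   endpoints. *)
have Hst s j t : 0 <= s <= 1 -> (t = 0 \/ t = 1) -> H s j t = b j t.
  move=> hs ht.
  have t01 : 0 <= t <= 1 by case: ht => ->.
  rewrite -(bcE j t t01); apply: Hc => // s' hs'.
  by have [e0 e1] := Gb s' hs'; case: ht => ->; rewrite ?e0 ?e1 G0.
have contH s j : continuous (H s j).
  apply: (continuous_compose (f := fun t => (s, t)) _ (cH j)).
  by apply: continuous_pair; solve_continuous.
have braidH s : 0 <= s <= 1 -> is_braid (fibre P w0) (H s).
  move=> hs; split.
  - by move=> j; apply: continuous_subspaceT; exact: contH.
  - by move=> t; rewrite itv => ht; exact: iH.
  - rewrite -b0; congr (_ @` _); apply/funext => j; apply: Hst => //; by left.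
  - rewrite -b1; congr (_ @` _); apply/funext => j; apply: Hst => //; by right.
pose lam t := w0 + c t.
have PE t : P - w0%:P - (c t)%:P = P - (lam t)%:P.
  by rewrite /lam polyCD opprD addrA.
exists lam, (H 1); split.
- split.
  + apply: continuous_subspaceT; apply: continuous_add => //.
    exact: continuous_const.
  + by rewrite /lam c0 addr0.
  + by rewrite /lam c1 addr0.
  + move=> t; rewrite itv => ht [z rz Pz].
    have := sG 1 t h11 ht; rewrite G1 // E0 PE => sl.
    by have := split_simple_shift_crit sl rz; rewrite Pz eqxx.
- split; first exact: braidH.
  move=> j t; rewrite itv => ht.
  have := rH 1 j t h11 ht; rewrite G1 // E0 PE.
  by rewrite /root hornerD hornerN hornerC subr_eq0 => /eqP.
(* [H] runs from [b] to the lifted braid; the isotopy is wanted in the other direction. *)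
- exists (fun s => H (1 - s)).
  have flip (s : R) : 0 <= s <= 1 -> 0 <= 1 - s <= 1 by lra.
  split.
  + move=> j; apply: continuous_subspaceT.
    apply: (continuous_compose (f := fun x : R * R => (1 - x.1, x.2)) _ (cH j)).
    by apply: continuous_pair; solve_continuous.
  + by move=> s; rewrite itv => /flip; exact: braidH.
  + move=> s j; rewrite itv => /flip hs.
    by rewrite !Hst; auto.
  + by move=> j t _; rewrite subr0.
  + by move=> j t; rewrite itv => ht; rewrite subrr H0 // bcE.
Qed.
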